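(* For any map $f\colon X\to Y$, $$\operatorname{nil}\bigl(\ker \cup\,|_{\operatorname{Im}(f\times f)^*}\bigr)\le \operatorname{TC}(f),$$ where $\ker\cup|_{\operatorname{Im}(f\times f)^*}$ denotes $\ker(\cup)\cap \operatorname{Im}\bigl((f\times f)^*\colon H^*(Y\times Y)\to H^*(X\times X)\bigr)$.
   Context: Conventions: all spaces are pointed, path-connected and of the homotopy type of a CW-complex, and (globally given) continuous maps preserve base points; maps defined on open subsets, and homotopies, are not required to be based. $H^*$ is (reduced) singular cohomology with coefficients in any fixed (commutative) ring, and $(-)^*$ denotes the induced morphism. The symbol $\cup$ denotes the morphism $\Delta^*\colon H^*(X\times X)\to H^*(X)$ induced by the diagonal $\Delta\colon X\to X\times X$; under the Künneth identification (when available, e.g. over a field and with finite type) it is the cup product $H^*(X)\otimes H^*(X)\to H^*(X)$. The nilpotency index $\operatorname{nil}R$ of a (non-unital) ring $R$ is the biggest $n\le\infty$ such that $R^n\neq 0$, i.e. such that some product of $n$ elements of $R$ is nonzero ($\operatorname{nil}R=0$ if $R=0$). For a space $X$ let $X^I$ be the space of continuous maps $I=[0,1]\to X$ and $\pi\colon X^I\to X\times X$, $\pi(\alpha)=(\alpha(0),\alpha(1))$. For a map $f\colon X\to Y$, $\operatorname{TC}(f)$ is the least $n\le\infty$ such that $X\times X$ can be covered by $n+1$ open sets $U_0,\dots,U_n$ on each of which there is a continuous map $\sigma_i\colon U_i\to X^I$ with $(f\times f)\circ\pi\circ\sigma_i\simeq (f\times f)|_{U_i}$. *)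

(* Defs.v *)
From HB Require Import structures.
From mathcomp Require Import all_boot all_order all_algebra.
From mathcomp Require Import generic_quotient ring_quotient zify.
From mathcomp Require Import all_classical all_reals all_analysis.
Import Order.TTheory GRing.Theory Num.Theory.
Import numFieldNormedType.Exports.

Set Implicit Arguments.
Unset Strict Implicit.
Unset Printing Implicit Defensive.

Local Open Scope classical_set_scope.
Local Open Scope ring_scope.
Local Open Scope quotient_scope.

(** * Singular simplices *)

Section StandardSimplex.
Variable R : realType.

Definition std_simplex (n : nat) : set 'rV[R]_n.+1 :=
  [set t | (forall i, 0 <= t 0 i) /\ \sum_i t 0 i = 1].
Arguments std_simplex : clear implicits.

Definition push_coord m n (v : nat -> nat) (t : 'rV[R]_m.+1) : 'rV[R]_n.+1 :=
  \row_(k < n.+1) \sum_(j < m.+1 | inord (v j) == k) t 0 j.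

Lemma push_coord_simplex m n (v : nat -> nat) (t : std_simplex m) :
  std_simplex n (push_coord n v (set_val t)).
Proof.
case: t => t; rewrite set_valE /= inE => -[t0 t1]; split=> [k|].
  by rewrite mxE sumr_ge0.
rewrite -[RHS]t1 [RHS](partition_big (fun j : 'I_m.+1 => inord (v j) : 'I_n.+1)
  xpredT) //=.
by apply: eq_bigr => k _; rewrite mxE.
Qed.

(** The affine map sending the vertex [j] to the vertex [v j]; only used when
    [v j <= n] for all [j <= m]. *)
Definition simplex_map m n (v : nat -> nat) (t : std_simplex m) :
  std_simplex n := SigSub (mem_set (push_coord_simplex n v t)).

Lemma push_coord_continuous m n v : continuous (@push_coord m n v).
Proof.
move=> t A [P tP PA].
have coordP i j : \forall s \near t, P i j (push_coord n v s i j).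
  have : continuous (fun s : 'rV[R]_m.+1 => push_coord n v s i j).
    have -> : (fun s => push_coord n v s i j) = (fun s : 'rV[R]_m.+1 =>
       \sum_(k < m.+1 | inord (v k) == j) s 0 k).
      by apply/funext => s; rewrite mxE.
    apply: continuous_big => [|k _]; last exact: coord_continuous.
    exact: add_continuous.
  by move=> /(_ t); apply; apply: tP.
have : \forall s \near t, forall i j, P i j (push_coord n v s i j).
  have Ft : Filter (nbhs t) by exact: nbhs_filter.
  apply: (filter_forall (f := fun i s => forall j, P i j (push_coord n v s i j)) Ft _) => i.
  exact: (filter_forall (f := fun j s => P i j (push_coord n v s i j)) Ft (coordP i)).
by apply: filterS => s; exact: PA.
Qed.

Lemma simplex_map_continuous m n v : continuous (@simplex_map m n v).
Proof.
apply: (@continuous_comp_initial (std_simplex n) (std_simplex m) _ set_val).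
have -> : set_val \o simplex_map n v = push_coord n v \o set_val by [].
move=> t; apply: continuous_comp; first exact: initial_continuous.
exact: push_coord_continuous.
Qed.

HB.instance Definition _ m n v :=
  isContinuous.Build _ _ (@simplex_map m n v) (@simplex_map_continuous m n v).

Lemma simplex_map_id n (t : std_simplex n) : simplex_map n id t = t.
Proof.
apply: val_inj; apply/rowP => k; rewrite mxE.
by under eq_bigl => j do rewrite inord_val; rewrite big_pred1_eq.
Qed.

Lemma eq_simplex_map m n v w (t : std_simplex m) :
  (forall j, (j <= m)%N -> v j = w j) -> simplex_map n v t = simplex_map n w t.
Proof.
move=> vw; apply: val_inj; apply/rowP => k; rewrite !mxE.
by apply: eq_bigl => j; rewrite vw // -ltnS.
Qed.

Lemma simplex_map_comp m n p v w (t : std_simplex m) :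
  (forall j, (j <= m)%N -> (w j <= n)%N) ->
  simplex_map p v (simplex_map n w t) = simplex_map p (v \o w) t.
Proof.
move=> wn; apply: val_inj; apply/rowP => k; rewrite !mxE.
rewrite [RHS](partition_big (fun j : 'I_m.+1 => inord (w j) : 'I_n.+1)
  (fun i => inord (v i) == k)) => [|j /eqP <-]; last first.
  by rewrite /= inordK // ltnS wn // -ltnS.
apply: eq_bigr => i /eqP <-; rewrite mxE; apply: eq_bigl => j /=.
case: eqP => [<-|]; rewrite ?andbF ?andbT //.
by rewrite inordK ?eqxx // ltnS wn // -ltnS.
Qed.

Definition singular (X : topologicalType) (n : nat) :=
  continuousType (std_simplex n) X.

Definition push_simplex (X Y : topologicalType) (f : continuousType X Y) n
  (s : singular X n) : singular Y n := f \o s.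

(** The face of [s] with vertices [v 0, ..., v m]. *)
Definition face (X : topologicalType) n (s : singular X n) m
  (v : nat -> nat) : singular X m := s \o simplex_map n v.

Section Faces.
Context {X : topologicalType}.
Implicit Types s : forall n, singular X n.

Lemma face_id n (s : singular X n) : face s n id = s.
Proof. by apply/continuousEP => t /=; rewrite simplex_map_id. Qed.

Lemma eq_face n (s : singular X n) m v w :
  (forall j, (j <= m)%N -> v j = w j) -> face s m v = face s m w.
Proof. by move=> vw; apply/continuousEP => t /=; rewrite (eq_simplex_map _ _ vw). Qed.

Lemma face_face n (s : singular X n) m p v w :
  (forall j, (j <= p)%N -> (w j <= m)%N) ->
  face (face s m v) p w = face s p (v \o w).
Proof. by move=> wm; apply/continuousEP => t /=; rewrite simplex_map_comp. Qed.

Lemma push_simplex_face (Y : topologicalType) (f : continuousType X Y) n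
    (s : singular X n) m v :
  push_simplex f (face s m v) = face (push_simplex f s) m v.
Proof. exact/continuousEP. Qed.

End Faces.
End StandardSimplex.

(** * The singular cohomology ring *)

(** A family of cochains, one in each degree, with coefficients in [A]
    ([R] is the real line, in which the standard simplices live); the cochain complex is the set of
    those families that satisfy [finitely_graded], i.e. the direct sum. *)
Definition cochain (R : realType) (A : comPzRingType) (X : topologicalType) :=
  forall n, singular R X n -> A.

HB.instance Definition _ R A X := gen_eqMixin (cochain R A X).
HB.instance Definition _ R A X := gen_choiceMixin (cochain R A X).

Section Cochains.
Context {R : realType} {A : comPzRingType} {X : topologicalType}.
Implicit Types a b c : cochain R A X.

Lemma cochainP a b : (forall n s, a n s = b n s) -> a = b.
Proof.
by move=> ab; apply: functional_extensionality_dep => n; apply/funext => s.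
Qed.

Definition cochain_zero : cochain R A X := fun n s => 0.
Definition cochain_opp a : cochain R A X := fun n s => - a n s.
Definition cochain_add a b : cochain R A X := fun n s => a n s + b n s.
Definition cochain_one : cochain R A X := fun n s => (n == 0)%N%:R.

(** The Alexander-Whitney cup product (front face times back face). *)
Definition cup a b : cochain R A X := fun n s =>
  \sum_(i < n.+1) a i (face s i id) * b (n - i)%N (face s (n - i) (addn i)).

(** [bump k] enumerates the vertices other than [k]. *)
Definition coboundary a : cochain R A X := fun n =>
  if n is m.+1 then
    fun s : singular R X m.+1 =>
      \sum_(k < m.+2) (-1) ^+ k * a m (face s m (bump k))
  else fun=> 0.

Definition finitely_graded a :=
  exists N, forall n s, (N <= n)%N -> a n s = 0.

Lemma cochain_addA : associative cochain_add.
Proof. by move=> a b c; apply: cochainP => n s; exact: addrA. Qed.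
Lemma cochain_addC : commutative cochain_add.
Proof. by move=> a b; apply: cochainP => n s; exact: addrC. Qed.
Lemma cochain_add0 : left_id cochain_zero cochain_add.
Proof. by move=> a; apply: cochainP => n s; exact: add0r. Qed.
Lemma cochain_addN : left_inverse cochain_zero cochain_opp cochain_add.
Proof. by move=> a; apply: cochainP => n s; exact: addNr. Qed.

HB.instance Definition _ := GRing.isZmodule.Build (cochain R A X)
  cochain_addA cochain_addC cochain_add0 cochain_addN.

Lemma cup_nat a b n (s : singular R X n) : cup a b s =
  \sum_(0 <= i < n.+1) a i (face s i id) * b (n - i)%N (face s (n - i) (addn i)).
Proof. by rewrite big_mkord. Qed.

Lemma triangle_sum n (F : nat -> nat -> A) :
  \sum_(0 <= i < n.+1) \sum_(0 <= j < i.+1) F i j =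
  \sum_(0 <= j < n.+1) \sum_(0 <= k < (n - j).+1) F (j + k)%N j.
Proof.
elim: n => [|n IHn]; first by rewrite !big_nat1.
rewrite big_nat_recr //= IHn [RHS]big_nat_recr //= subnn big_nat1 addn0.
rewrite [X in _ + X]big_nat_recr //= addrA -big_split /=; congr (_ + _).
apply: eq_big_nat => j /andP[_ jn].
by rewrite subSn // [RHS]big_nat_recr //= addnS subnKC.
Qed.

Lemma cupA : associative cup.
Proof.
move=> a b c; apply: cochainP => n s; rewrite !cup_nat.
pose F i j := a j (face s j id) * b (i - j)%N (face s (i - j) (addn j)) *
  c (n - i)%N (face s (n - i) (addn i)).
transitivity (\sum_(0 <= i < n.+1) \sum_(0 <= j < i.+1) F i j); last first.
  apply: eq_big_nat => i /andP[_ lt_in]; rewrite cup_nat mulr_suml.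
  apply: eq_big_nat => j /andP[_ lt_ji]; rewrite /F.
  rewrite !face_face //; first by move=> k; lia.
  by move=> k; lia.
rewrite triangle_sum; apply: eq_big_nat => j /andP[_ lt_jn].
rewrite cup_nat mulr_sumr; apply: eq_big_nat => k /andP[_ lt_kn].
rewrite /F -mulrA addKn subnDA !face_face; try by move=> l; lia.
rewrite (eq_face s (v := addn j \o addn k) (w := addn (j + k))) // => l _ /=.
by rewrite addnA.
Qed.

Lemma cup1c : left_id cochain_one cup.
Proof.
move=> a; apply: cochainP => n s; rewrite /cup big_ord_recl /=.
rewrite big1 ?addr0 => [|i _]; last by rewrite /cochain_one mul0r.
by rewrite /cochain_one mul1r subn0 face_id.
Qed.

Lemma cupc1 : right_id cochain_one cup.
Proof.
move=> a; apply: cochainP => n s; rewrite /cup big_ord_recr /=.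
rewrite big1 ?add0r => [|i _]; last first.
  by rewrite /cochain_one subn_eq0 leqNgt ltn_ord mulr0.
by rewrite /cochain_one subnn mulr1 face_id.
Qed.

Lemma cupDl : left_distributive cup cochain_add.
Proof.
move=> a b c; apply: cochainP => n s; rewrite /cup /cochain_add -big_split /=.
by apply: eq_bigr => i _; rewrite mulrDl.
Qed.

Lemma cupDr : right_distributive cup cochain_add.
Proof.
move=> a b c; apply: cochainP => n s; rewrite /cup /cochain_add -big_split /=.
by apply: eq_bigr => i _; rewrite mulrDr.
Qed.

HB.instance Definition _ := GRing.Zmodule_isPzRing.Build (cochain R A X)
  cupA cup1c cupc1 cupDl cupDr.

Lemma cochainBE a b n s : (a - b) n s = a n s - b n s. Proof. by []. Qed.
Lemma cochainDE a b n s : (a + b) n s = a n s + b n s. Proof. by []. Qed.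
Lemma cochainNE a n s : (- a) n s = - a n s. Proof. by []. Qed.

Lemma cupE a b n s : (a * b) n s =
  \sum_(i < n.+1) a i (face s i id) * b (n - i)%N (face s (n - i) (addn i)).
Proof. by []. Qed.

Lemma coboundaryB a b : coboundary (a - b) = coboundary a - coboundary b.
Proof.
apply: cochainP => -[|n] s; first by rewrite cochainBE subrr.
rewrite cochainBE /coboundary -sumrB; apply: eq_bigr => k _.
by rewrite cochainBE mulrBr.
Qed.

Definition sign_twist a : cochain R A X := fun n s => (-1) ^+ n * a n s.

Lemma sign_twistK : involutive sign_twist.
Proof. by move=> a; apply: cochainP => n s; rewrite /sign_twist signrMK. Qed.

Lemma coboundary_twist a : coboundary (sign_twist a) = - sign_twist (coboundary a).
Proof.
apply: cochainP => -[|n] s; rewrite cochainNE /sign_twist /=; first by rewrite mulr0 oppr0.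
rewrite exprS mulN1r mulNr opprK /= mulr_sumr.
by apply: eq_bigr => k _; rewrite mulrCA.
Qed.

(** The Leibniz rule. *)
Lemma coboundary_cup a b :
  coboundary (a * b) = coboundary a * b + sign_twist a * coboundary b.
Proof.
apply: cochainP => -[|n] s.
  by rewrite cochainDE !cupE !big_ord1 /= mul0r mulr0 addr0.
pose P i k := a i (face s i (bump k)).
pose Q i k := b (n - i)%N (face s (n - i) (fun j => bump k (i + j))).
pose P' i := a i (face s i id).
pose Q' i := b (n - i)%N (face s (n - i) (addn i.+1)).
have PP' i k : (i < k)%N -> P i k = P' i.
  move=> ik; rewrite /P /P'.
  rewrite (eq_face s (v := bump k) (w := id)) // => j ji.
  by rewrite /bump leqNgt (leq_ltn_trans ji ik).
have QQ' i k : (k <= i)%N -> Q i k = Q' i.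
  move=> ki; rewrite /Q /Q'.
  rewrite (eq_face s (w := addn i.+1)) // => j _.
  by rewrite /bump (leq_trans ki) ?leq_addr.
transitivity (\sum_(i < n.+1) \sum_(0 <= k < n.+2) (-1) ^+ k * (P i k * Q i k)).
  rewrite /coboundary.
  under [RHS]eq_bigr do rewrite big_mkord.
  rewrite exchange_big; apply: eq_bigr => k _; rewrite cupE mulr_sumr.
  apply: eq_bigr => i _; have lt_in := ltn_ord i.
  by rewrite !face_face //; move=> j; lia.
transitivity (\sum_(i < n.+1) ((\sum_(0 <= k < i.+2) (-1) ^+ k * P i k) * Q' i +
    (-1) ^+ i * P' i * \sum_(0 <= l < (n - i).+2) (-1) ^+ l * Q i (i + l)%N)).
  apply: eq_bigr => i _; have lt_in := ltn_ord i.
  rewrite (@big_cat_nat _ _ _ i.+1) //=; last by lia.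
  rewrite [X in _ = X * _ + _]big_nat_recr //= mulrDl PP' //.
  rewrite [X in _ = _ + _ * X]big_nat_recl // addn0 expr0 mul1r QQ' //.
  rewrite mulrDr exprS mulN1r !mulNr addrA subrK mulr_suml mulr_sumr.
  congr (_ + _).
    by apply: eq_big_nat => k /andP[_ ki]; rewrite QQ' ?mulrA.
  rewrite -{1}[i.+1]add0n big_addn.
  have -> : (n.+2 - i.+1 = (n - i).+1)%N by lia.
  apply: eq_big_nat => k _; rewrite PP' ?leq_addl //.
  have -> : (k + i.+1 = i + k.+1)%N by lia.
  by rewrite exprD !mulrA; congr (_ * _); rewrite mulrAC.
rewrite big_split /= cochainDE !cupE; congr (_ + _).
  rewrite [RHS]big_ord_recl /= mul0r add0r; apply: eq_bigr => i _.
  transitivity (coboundary a (face s i.+1 id) *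
    b (n.+1 - i.+1)%N (face s (n.+1 - i.+1) (addn i.+1))); last by [].
  rewrite subSS big_mkord !mulr_suml.
  apply: eq_bigr => k _; rewrite face_face // => j.
  by rewrite /bump; case: (k <= j)%N; lia.
rewrite [RHS]big_ord_recr /= subnn mulr0 addr0; apply: eq_bigr => i _.
have lt_in := ltn_ord i; rewrite subSn -1?ltnS //= big_mkord.
rewrite !mulr_sumr; apply: eq_bigr => k _; rewrite face_face => [|j]; last first.
  by rewrite /bump; case: (k <= j)%N; lia.
rewrite /Q (eq_face s (w := addn i \o bump k)) // => j _ /=.
by rewrite /bump leq_add2l addnCA.
Qed.

Lemma finitely_gradedB a b :
  finitely_graded a -> finitely_graded b -> finitely_graded (a - b).
Proof.
move=> [N aN] [M bM]; exists (maxn N M) => n s; rewrite geq_max => /andP[nN nM].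
by rewrite cochainBE aN // bM // subr0.
Qed.

Lemma finitely_graded_cup a b :
  finitely_graded a -> finitely_graded b -> finitely_graded (a * b).
Proof.
move=> [N aN] [M bM]; exists (N + M)%N => n s NMn; rewrite cupE big1 // => i _.
have [Ni|iN] := leqP N i; first by rewrite aN // mul0r.
by rewrite bM ?mulr0 //; lia.
Qed.

Lemma finitely_graded_twist a : finitely_graded a -> finitely_graded (sign_twist a).
Proof. by move=> [N aN]; exists N => n s Nn; rewrite /sign_twist aN // mulr0. Qed.

Lemma finitely_graded1 : finitely_graded 1.
Proof. by exists 1%N => -[|n] s. Qed.

Lemma coboundary1 : coboundary 1 = 0.
Proof.
apply: cochainP => -[|[|n]] s //=; last by rewrite big1 // => i _; rewrite mulr0.
by rewrite !big_ord_recl big_ord0 /= !mulr1 expr0 expr1 addr0 subrr.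
Qed.

Definition is_cocycle : {pred cochain R A X} :=
  fun a => `[< finitely_graded a /\ coboundary a = 0 >].

Lemma is_cocycle_subring : subring_closed is_cocycle.
Proof.
split=> [|a b /asboolP[aF a0] /asboolP[bF b0]|a b /asboolP[aF a0] /asboolP[bF b0]];
    apply/asboolP; split.
- exact: finitely_graded1.
- exact: coboundary1.
- exact: finitely_gradedB.
- by rewrite coboundaryB a0 b0 subr0.
- exact: finitely_graded_cup.
- by rewrite coboundary_cup a0 b0 mul0r mulr0 addr0.
Qed.

End Cochains.

Record cocycle (R : realType) (A : comPzRingType) (X : topologicalType) :=
  Cocycle { cocycle_val : cochain R A X; cocycleP : is_cocycle cocycle_val }.

Section Cohomology.
Context {R : realType} {A : comPzRingType} {X : topologicalType}.
Implicit Types a b : cocycle R A X.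

HB.instance Definition _ := [isSub for @cocycle_val R A X].
HB.instance Definition _ := [Choice of cocycle R A X by <:].
HB.instance Definition _ := GRing.SubChoice_isSubPzRing.Build
  (cochain R A X) is_cocycle (cocycle R A X) is_cocycle_subring.

Definition coboundaries : {pred cocycle R A X} := fun a =>
  `[< exists2 e : cochain R A X, finitely_graded e & val a = coboundary e >].

Lemma coboundaries_zmod : zmod_closed coboundaries.
Proof.
split=> [|a b /asboolP[e eF ae] /asboolP[e' e'F be']]; apply/asboolP.
  exists 0; first by exists 0%N.
  by rewrite -[X in coboundary X](subrr 0) coboundaryB subrr.
by exists (e - e'); [exact: finitely_gradedB | rewrite coboundaryB -ae -be'].
Qed.

HB.instance Definition _ := GRing.isZmodClosed.Build _ coboundaries
  coboundaries_zmod.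

Lemma coboundariesMr a b : b \in coboundaries -> a * b \in coboundaries.
Proof.
have /asboolP[aF a0] := cocycleP a.
move=> /asboolP[e eF be]; apply/asboolP; exists (sign_twist (val a) * e).
  by apply: finitely_graded_cup => //; exact: finitely_graded_twist.
rewrite coboundary_cup coboundary_twist a0 sign_twistK -be.
suff -> : sign_twist (0 : cochain R A X) = 0 by rewrite oppr0 mul0r add0r.
by apply: cochainP => n s; rewrite /sign_twist mulr0.
Qed.

Lemma coboundariesMl a b : a \in coboundaries -> a * b \in coboundaries.
Proof.
have /asboolP[bF b0] := cocycleP b.
move=> /asboolP[e eF ae]; apply/asboolP; exists (e * val b).
  exact: finitely_graded_cup.
by rewrite coboundary_cup b0 mulr0 addr0 -ae.
Qed.

End Cohomology.

(** The total (unreduced) singular cohomology ring of [X], with coefficients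
    in [A]. *)
Definition cohomology (R : realType) (A : comPzRingType) (X : topologicalType) :=
  Quotient.quot (@coboundaries R A X).

Section CohomologyRing.
Context {R : realType} {A : comPzRingType} {X : topologicalType}.
Local Notation H := (cohomology R A X).

HB.instance Definition _ : EqQuotient _ _ H := EqQuotient.on H.
HB.instance Definition _ := GRing.Zmodule.on H.

Definition cohom_class (a : cocycle R A X) : H := \pi_H a.
Definition cohom_mul (x y : H) : H := cohom_class (repr x * repr y).

Lemma cohom_classK (x : H) : cohom_class (repr x) = x.
Proof. exact: reprK. Qed.

Lemma cohom_classP (a b : cocycle R A X) :
  cohom_class a = cohom_class b <-> a - b \in coboundaries.
Proof. by rewrite Quotient.idealrBE; split => [/eqP|/eqP]. Qed.

Lemma cohom_classD a b : cohom_class (a + b) = cohom_class a + cohom_class b.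
Proof. by rewrite /cohom_class !piE. Qed.

Lemma cohom_mulE a b :
  cohom_mul (cohom_class a) (cohom_class b) = cohom_class (a * b).
Proof.
apply/cohom_classP; set a' := repr _; set b' := repr _.
have a'a : a' - a \in coboundaries by apply/cohom_classP; rewrite cohom_classK.
have b'b : b' - b \in coboundaries by apply/cohom_classP; rewrite cohom_classK.
rewrite -(subrK (a' * b) (a' * b')) -addrA -mulrBr -mulrBl.
by apply: rpredD; [exact: coboundariesMr | exact: coboundariesMl].
Qed.

Lemma cohom_mulA : associative cohom_mul.
Proof.
move=> x y z; rewrite -[x]cohom_classK -[y]cohom_classK -[z]cohom_classK.
by rewrite !cohom_mulE mulrA.
Qed.

Lemma cohom_mul1x : left_id (cohom_class 1) cohom_mul.
Proof. by move=> x; rewrite -[x]cohom_classK cohom_mulE mul1r. Qed.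

Lemma cohom_mulx1 : right_id (cohom_class 1) cohom_mul.
Proof. by move=> x; rewrite -[x]cohom_classK cohom_mulE mulr1. Qed.

Lemma cohom_mulDl : left_distributive cohom_mul +%R.
Proof.
move=> x y z; rewrite -[x]cohom_classK -[y]cohom_classK -[z]cohom_classK.
by rewrite -cohom_classD !cohom_mulE -cohom_classD mulrDl.
Qed.

Lemma cohom_mulDr : right_distributive cohom_mul +%R.
Proof.
move=> x y z; rewrite -[x]cohom_classK -[y]cohom_classK -[z]cohom_classK.
by rewrite -cohom_classD !cohom_mulE -cohom_classD mulrDr.
Qed.

HB.instance Definition _ := GRing.Zmodule_isPzRing.Build H
  cohom_mulA cohom_mul1x cohom_mulx1 cohom_mulDl cohom_mulDr.

Lemma cohom_classB a b : cohom_class (a - b) = cohom_class a - cohom_class b.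
Proof. by rewrite /cohom_class !piE. Qed.

Lemma cohom_classM a b : cohom_class (a * b) = cohom_class a * cohom_class b.
Proof. by rewrite -cohom_mulE. Qed.

End CohomologyRing.

Section InducedMap.
Context {R : realType} {A : comPzRingType} {X Y : topologicalType}.
Variable f : continuousType X Y.

Definition cochain_pull (a : cochain R A Y) : cochain R A X :=
  fun n s => a n (push_simplex f s).

Lemma cochain_pull_coboundary a :
  cochain_pull (coboundary a) = coboundary (cochain_pull a).
Proof.
apply: cochainP => -[|n] s //; apply: eq_bigr => k _.
by rewrite /cochain_pull push_simplex_face.
Qed.

Lemma cochain_pull_finite a : finitely_graded a -> finitely_graded (cochain_pull a).
Proof. by move=> [N aN]; exists N => n s; exact: aN. Qed.

Lemma cochain_pull_is_cocycle (a : cocycle R A Y) :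
  is_cocycle (cochain_pull (cocycle_val a)).
Proof.
have /asboolP[aF a0] := cocycleP a; apply/asboolP; split.
  exact: cochain_pull_finite.
by rewrite -cochain_pull_coboundary a0.
Qed.

Definition cocycle_pull (a : cocycle R A Y) : cocycle R A X :=
  Cocycle (cochain_pull_is_cocycle a).

Lemma cocycle_pullB a b : cocycle_pull (a - b) = cocycle_pull a - cocycle_pull b.
Proof. exact: val_inj. Qed.

Lemma cocycle_pull1 : cocycle_pull 1 = 1.
Proof. exact: val_inj. Qed.

Lemma cocycle_pullM a b : cocycle_pull (a * b) = cocycle_pull a * cocycle_pull b.
Proof.
apply: val_inj; apply: cochainP => n s; rewrite [RHS]cupE.
rewrite [LHS]cupE; apply: eq_bigr => i _.
by rewrite /= /cochain_pull !push_simplex_face.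
Qed.

(** The induced ring morphism [f^*]; by [cohom_pull_class] it does not depend
    on the representative. *)
Definition cohom_pull (x : cohomology R A Y) : cohomology R A X :=
  cohom_class (cocycle_pull (repr x)).

Lemma cohom_pull_class a : cohom_pull (cohom_class a) = cohom_class (cocycle_pull a).
Proof.
apply/cohom_classP; rewrite -cocycle_pullB; set a' := repr _.
have /asboolP[e eF ae] : a' - a \in coboundaries.
  by apply/cohom_classP; rewrite cohom_classK.
apply/asboolP; exists (cochain_pull e); first exact: cochain_pull_finite.
by rewrite -cochain_pull_coboundary -ae.
Qed.

Lemma cohom_pull_zmod : zmod_morphism cohom_pull.
Proof.
move=> x y; rewrite -[x]cohom_classK -[y]cohom_classK -cohom_classB.
by rewrite !cohom_pull_class cocycle_pullB cohom_classB.
Qed.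

Lemma cohom_pull_monoid : monoid_morphism cohom_pull.
Proof.
split=> [|x y]; first by rewrite (cohom_pull_class 1) cocycle_pull1.
rewrite -[x]cohom_classK -[y]cohom_classK -cohom_classM.
by rewrite !cohom_pull_class cocycle_pullM cohom_classM.
Qed.

HB.instance Definition _ := GRing.isZmodMorphism.Build _ _ cohom_pull
  cohom_pull_zmod.
HB.instance Definition _ := GRing.isMonoidMorphism.Build _ _ cohom_pull
  cohom_pull_monoid.

End InducedMap.

Definition incl (X : topologicalType) (S : set X) : S -> X := set_val.

Lemma incl_continuous (X : topologicalType) (S : set X) : continuous (@incl X S).
Proof. exact: initial_continuous. Qed.

HB.instance Definition _ X S :=
  isContinuous.Build _ _ (@incl X S) (@incl_continuous X S).

Definition diag (X : topologicalType) (x : X) : X * X := (x, x).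

Lemma diag_continuous (X : topologicalType) : continuous (@diag X).
Proof. by move=> x; apply: cvg_pair; exact: cvg_id. Qed.

HB.instance Definition _ X := isContinuous.Build _ _ (@diag X) (@diag_continuous X).

Definition square_map (X Y : topologicalType) (f : continuousType X Y)
  (p : X * X) : Y * Y := (f p.1, f p.2).

Lemma square_map_continuous (X Y : topologicalType) (f : continuousType X Y) :
  continuous (square_map f).
Proof.
move=> p; apply: cvg_pair.
  by apply: cvg_comp; [exact: cvg_fst | exact: cts_fun].
by apply: cvg_comp; [exact: cvg_snd | exact: cts_fun].
Qed.

HB.instance Definition _ (X Y : topologicalType) (f : continuousType X Y) :=
  isContinuous.Build _ _ (square_map f) (@square_map_continuous X Y f).

(** Reduced cohomology of the pointed space [(X, x0)], realised as the
    non-unital subring [ker (H^*(X) -> H^*({x0}))] of [H^*(X)]. *)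
Definition reduced_cohomology (R : realType) (A : comPzRingType)
    (X : topologicalType) (x0 : X) : set (cohomology R A X) :=
  [set x | cohom_pull (@incl X [set x0]) x = 0].

(** [ker (cup) /\ Im (f x f)^*], where [cup] is the morphism induced by the
    diagonal. *)
Definition ker_cup_im (R : realType) (A : comPzRingType)
    (X Y : ptopologicalType) (f : continuousType X Y) :
    set (cohomology R A (X * X)%type) :=
  [set x | reduced_cohomology (point, point) x /\ cohom_pull (@diag X) x = 0] `&`
  cohom_pull (square_map f) @` reduced_cohomology (point, point).
Arguments ker_cup_im R A {X Y} f.

(** The value [n = 0] is always allowed, so that the index of the zero ring
    is 0; the empty product is never used. *)
Definition nil_index (R : realType) (H : pzRingType) (S : set H) : \bar R :=
  ereal_sup [set n%:R%:E | n in [set n : nat | n = 0%N \/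
    exists x : 'I_n -> H, (forall i, S (x i)) /\ \prod_(i < n) x i != 0]].
Arguments nil_index R {H} S.

(** * Homotopy and topological complexity of a map *)

Section UnitInterval.
Variable R : realType.

Definition unit_interval : set R := `[0, 1]%classic.

Lemma unit_interval0 : 0 \in unit_interval.
Proof. by rewrite inE /unit_interval /= in_itv /= lexx ler01. Qed.

Lemma unit_interval1 : 1 \in unit_interval.
Proof. by rewrite inE /unit_interval /= in_itv /= lexx ler01. Qed.

Definition I0 : unit_interval := SigSub unit_interval0.
Definition I1 : unit_interval := SigSub unit_interval1.

End UnitInterval.
Arguments unit_interval : clear implicits.

Definition path_space (R : realType) (X : topologicalType) : Type :=
  continuousType (unit_interval R) X.

HB.instance Definition _ R X := Topological.copy (path_space R X)
  (@initial_topology (continuousType (unit_interval R) X)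
    {compact-open, unit_interval R -> X} id).

Section Homotopy.
Variable R : realType.
Local Notation unit_interval := (unit_interval R).
Local Notation path_space := (path_space R).
Local Notation I0 := (I0 R).
Local Notation I1 := (I1 R).

Definition homotopic (X Y : topologicalType) (f g : X -> Y) :=
  exists h : X * unit_interval -> Y, [/\ continuous h,
    forall x, h (x, I0) = f x & forall x, h (x, I1) = g x].

Definition path_at (X : topologicalType) (alpha : path_space X)
  (t : unit_interval) : X := (alpha : continuousType unit_interval X) t.

Definition endpoints (X : topologicalType) (alpha : path_space X) : X * X :=
  (path_at alpha I0, path_at alpha I1).

Definition path_connected (X : topologicalType) :=
  forall x y : X, exists alpha : path_space X, endpoints alpha = (x, y).

Definition tc_cover (X Y : topologicalType) (f : continuousType X Y) (n : nat) :=
  exists U : 'I_n.+1 -> set (X * X), [/\ forall i, open (U i),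
    \bigcup_i U i = setT &
    forall i, exists sigma : U i -> path_space X, continuous sigma /\
      homotopic (square_map f \o @endpoints X \o sigma)
                (square_map f \o @incl _ (U i))].

Definition TC (X Y : topologicalType) (f : continuousType X Y) : \bar R :=
  ereal_inf [set n%:R%:E | n in tc_cover f].

Definition homotopy_equivalent (X Y : topologicalType) :=
  exists (f : X -> Y) (g : Y -> X), [/\ continuous f, continuous g,
    homotopic (g \o f) id & homotopic (f \o g) id].

Definition disk n : set 'rV[R]_n := [set x | \sum_i x 0 i ^+ 2 <= 1].
Definition open_disk n : set 'rV[R]_n := [set x | \sum_i x 0 i ^+ 2 < 1].
Definition sphere n : set 'rV[R]_n := [set x | \sum_i x 0 i ^+ 2 = 1].
Arguments disk : clear implicits.
Arguments open_disk : clear implicits.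
Arguments sphere : clear implicits.

(** [J n] indexes the [n]-cells and [phi j] is the characteristic map of the
    cell [j] (only its restriction to the disk matters).  The fields are
    Whitehead's axioms: the open cells partition the space, the boundary of a
    cell meets only finitely many cells, of smaller dimension (closure
    finiteness), and the space has the weak topology. *)
Record CW_structure (K : topologicalType) (J : nat -> Type)
    (phi : forall n, J n -> 'rV[R]_n -> K) : Prop := {
  CW_hausdorff : hausdorff_space K;
  CW_continuous : forall n (j : J n), {within disk n, continuous (phi n j)};
  CW_injective : forall n (j j' : J n) x x', open_disk n x -> open_disk n x' ->
    phi n j x = phi n j' x' -> j = j' /\ x = x';
  CW_disjoint : forall m n (i : J m) (j : J n) x y,
    open_disk m x -> open_disk n y -> phi m i x = phi n j y -> m = n;
  CW_cover : forall p : K, exists n (j : J n), (phi n j @` open_disk n) p;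
  CW_closure_finite : forall n (j : J n),
    exists N (c : 'I_N -> {m : nat & J m}), (forall i, (tag (c i) < n)%N) /\
      phi n j @` sphere n `<=`
        \bigcup_i (phi (tag (c i)) (tagged (c i)) @` open_disk (tag (c i)));
  CW_weak_topology : forall C : set K,
    (forall n (j : J n), closed (disk n `&` phi n j @^-1` C)) -> closed C
}.

Definition CW_complex (K : topologicalType) :=
  exists (J : nat -> Type) (phi : forall n, J n -> 'rV[R]_n -> K),
    CW_structure phi.

Definition CW_homotopy_type (X : topologicalType) :=
  exists K : topologicalType, CW_complex K /\ homotopy_equivalent X K.

End Homotopy.

Arguments TC R {X Y} f.

(* Main.v *)
Require Import Defs.
From HB Require Import structures.
From mathcomp Require Import all_boot all_order all_algebra.
From mathcomp Require Import zify ring lra.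
From mathcomp Require Import all_classical all_reals all_analysis.
Import Order.TTheory GRing.Theory Num.Theory.
Import numFieldNormedType.Exports.

Set Implicit Arguments.
Unset Strict Implicit.
Unset Printing Implicit Defensive.

(** Let U_0, ..., U_n be an open cover of X x X with partial sections sigma_i up
    to f x f.  A class x in the kernel of the cup product that comes from
    Y x Y restricts to zero on each U_i: up to homotopy, f x f factors on U_i
    through the space of paths of X, and this space retracts by deformation onto
    the constant paths, which x does not see because its pull-back along the
    diagonal is zero ([ker_cup_im_restrict]).

    A class that restricts to zero on U_i is represented by a cocycle that
    vanishes on all simplices inside U_i ([vanishing_representative]).  The
    product of n + 1 such cocycles, one for each i, vanishes on every simplex that
    lies in some U_i, and is thus a coboundary ([prod_eq0_of_cover]).  So a
    non-zero product has at most n factors.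

    Two facts of singular cohomology carry this: homotopy invariance
    ([cohom_pull_homotopic]) and the theorem of small simplices, in the form that
    a cocycle which vanishes on the simplices inside the members of an open cover
    is a coboundary ([small_cocycle_coboundary]).  Both come from the same
    construction.  A cochain and a singular simplex on the standard simplex of
    dimension n give a function on finite lists of points, namely the value of
    the cochain on the affine simplex spanned by the list.  On such functions,
    coning a list from a point yields explicit chain homotopies by recursion
    ([cone_homotopy_coboundary]): one between the identity and barycentric
    subdivision, and one between the two ends of a prism. *)

Local Open Scope classical_set_scope.
Local Open Scope ring_scope.

(** * Cochains on lists of vertices *)

Lemma size_induction (V : Type) (P : seq V -> Prop) :
  (forall w, (forall l, (size l < size w)%N -> P l) -> P w) -> forall w, P w.
Proof.
move=> IH w; have [n] := ubnP (size w); elim: n w => // n IHn w wn.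
by apply: IH => l lw; apply: IHn; apply: leq_trans lw _.
Qed.

Lemma subrACA (A : zmodType) (x y z t : A) : (x - y) - (z - t) = (x - z) - (y - t).
Proof. by rewrite !opprD !opprK addrACA. Qed.

Section ListCochains.
Variable A : zmodType.
Implicit Types V W : Type.

(** Dual to the boundary of formal simplices [x :: l], which satisfies
    d(x :: l) = l - x :: d l.  Written this way, coning is a
    contracting homotopy by definition.  The empty list is kept as a simplex of dimension
    -1: it plays the role of the augmentation, so that the chain homotopies
    below need no separate treatment of dimension 0. *)
Fixpoint list_coboundary V (phi : seq V -> A) (w : seq V) : A :=
  if w is x :: l then phi l - list_coboundary (fun l' => phi (x :: l')) l else 0.
Local Notation d := list_coboundary.

Definition cone V (b : V) (phi : seq V -> A) : seq V -> A := fun l => phi (b :: l).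

Lemma eq_list_coboundary V (phi psi : seq V -> A) w :
  (forall l, size l = (size w).-1 -> phi l = psi l) -> d phi w = d psi w.
Proof.
elim: w phi psi => //= x l IHl phi psi phipsi; rewrite phipsi //; congr (_ - _).
by case: l IHl phipsi => // y l IHl phipsi; apply: IHl => l' /= l'l; apply: phipsi => /=; lia.
Qed.

Lemma list_coboundaryB V (phi psi : seq V -> A) w :
  d (fun l => phi l - psi l) w = d phi w - d psi w.
Proof.
elim: w phi psi => [|x l IHl] phi psi /=; first by rewrite subrr.
by rewrite IHl subrACA.
Qed.

Lemma list_coboundaryK V (phi : seq V -> A) w : d (d phi) w = 0.
Proof.
elim: w phi => //= x l IHl phi; rewrite list_coboundaryB IHl subr0.
by rewrite subrr.
Qed.

Lemma list_coboundary_map V W (g : V -> W) (phi : seq W -> A) w :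
  d phi (map g w) = d (phi \o map g) w.
Proof. by elim: w phi => //= x l IHl phi; rewrite IHl. Qed.

Lemma cone_coboundary V (b : V) (phi : seq V -> A) l :
  cone b (d phi) l = phi l - d (cone b phi) l.
Proof. by []. Qed.

Section Subdivision.
Variables (V : Type) (b : seq V -> V).

(** Dual to the recursion S w = b(w) :: S(d w) that defines barycentric
    subdivision when [b w] is the barycenter of [w].  The fuel [n] is the number
    of vertices. *)
Fixpoint subdivide_rec n (phi : seq V -> A) (w : seq V) : A :=
  if n is m.+1 then d (subdivide_rec m (cone (b w) phi)) w else phi w.

Definition subdivide phi w := subdivide_rec (size w) phi w.

Lemma subdivide_cons phi w : (0 < size w)%N ->
  subdivide phi w = d (subdivide (cone (b w) phi)) w.
Proof.
case: w => // x l _; rewrite /subdivide.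
by apply: eq_list_coboundary => l' l'l; rewrite l'l.
Qed.

Lemma eq_subdivide phi psi w :
  (forall l, size l = size w -> phi l = psi l) -> subdivide phi w = subdivide psi w.
Proof.
elim/size_induction: w phi psi => -[|x w] IHw phi psi phipsi; first exact: phipsi.
rewrite !subdivide_cons //; apply: eq_list_coboundary => l ln.
apply: IHw => [|l' l'l]; first by rewrite ln.
by apply: phipsi; rewrite /= l'l ln.
Qed.

Lemma subdivideB phi psi w :
  subdivide (fun l => phi l - psi l) w = subdivide phi w - subdivide psi w.
Proof.
elim/size_induction: w phi psi => -[|x w] IHw phi psi //.
rewrite !subdivide_cons // -list_coboundaryB.
by apply: eq_list_coboundary => l ln; rewrite -IHw ?ln.
Qed.

(** Subdivision is a chain map.  Both sides are the coboundary of a function on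
    the faces of [w]; there [cone_coboundary] and the induction hypothesis make
    them differ by a coboundary, which [list_coboundaryK] kills. *)
Lemma subdivide_coboundary phi w : subdivide (d phi) w = d (subdivide phi) w.
Proof.
elim/size_induction: w phi => -[|x w] IHw phi //.
rewrite subdivide_cons //.
transitivity (d (fun l => subdivide phi l - d (subdivide (cone (b (x :: w)) phi)) l) (x :: w)).
  apply: eq_list_coboundary => l ln; rewrite -IHw ?ln // -subdivideB.
  by apply: eq_subdivide => l' _; rewrite cone_coboundary.
by rewrite list_coboundaryB list_coboundaryK subr0.
Qed.

End Subdivision.

Lemma subdivide_map V W (bV : seq V -> V) (bW : seq W -> W) (g : V -> W)
    (phi : seq W -> A) w :
  (forall l, (0 < size l)%N -> bW (map g l) = g (bV l)) ->
  subdivide bW phi (map g w) = subdivide bV (phi \o map g) w.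
Proof.
move=> bg; elim/size_induction: w phi => -[|x w] IHw phi //.
rewrite !subdivide_cons ?size_map // bg // list_coboundary_map.
by apply: eq_list_coboundary => l ln; rewrite /= IHw ?ln.
Qed.

Section ConeHomotopy.
Variables (V W : Type) (b : seq V -> W).
Variable F : (seq W -> A) -> seq V -> A.
Hypothesis FB : forall phi psi w, F (fun l => phi l - psi l) w = F phi w - F psi w.
Hypothesis F_coboundary : forall phi w, F (d phi) w = d (F phi) w.
Hypothesis F_local : forall phi psi w,
  (forall l, size l = size w -> phi l = psi l) -> F phi w = F psi w.
Hypothesis F_nil : forall phi, F phi [::] = 0.

(** Dual to the recursion D w = b(w) :: (F w - D(d w)), the acyclic models
    construction of a null-homotopy of [F] inside cones.  It is used for [F] the
    difference of the identity and the subdivision, and for [F] the difference of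
    the two ends of a prism. *)
Fixpoint cone_homotopy_rec n (phi : seq W -> A) (w : seq V) : A :=
  if n is m.+1 then
    F (cone (b w) phi) w - d (cone_homotopy_rec m (cone (b w) phi)) w
  else 0.

Definition cone_homotopy phi w := cone_homotopy_rec (size w) phi w.
Local Notation D := cone_homotopy.

Lemma cone_homotopy_cons phi w : (0 < size w)%N ->
  D phi w = F (cone (b w) phi) w - d (D (cone (b w) phi)) w.
Proof.
case: w => // x l _; rewrite /D [LHS]/cone_homotopy_rec; congr (_ - _).
by apply: eq_list_coboundary => l' l'l; rewrite l'l.
Qed.

Lemma cone_homotopyB phi psi w : D (fun l => phi l - psi l) w = D phi w - D psi w.
Proof.
elim/size_induction: w phi psi => -[|x w] IHw phi psi; first by rewrite /D subrr.
rewrite !cone_homotopy_cons // FB subrACA -list_coboundaryB; congr (_ - _).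
by apply: eq_list_coboundary => l ln; rewrite -IHw ?ln.
Qed.

Lemma eq_cone_homotopy phi psi w :
  (forall l, size l = (size w).+1 -> phi l = psi l) -> D phi w = D psi w.
Proof.
elim/size_induction: w phi psi => -[|x w] IHw phi psi phipsi //.
rewrite !cone_homotopy_cons //; congr (_ - _).
  by apply: F_local => l lw; apply: phipsi; rewrite /= lw.
apply: eq_list_coboundary => l lw; apply: IHw => [|l' l'l]; first by rewrite lw.
by apply: phipsi; rewrite /= l'l lw.
Qed.

Lemma cone_homotopy_eq0 phi w :
  (forall l, size l = (size w).+1 -> phi l = 0) -> D phi w = 0.
Proof.
move=> phi0; rewrite -(subrr (D (fun=> 0) w)) -cone_homotopyB.
by apply: eq_cone_homotopy => l /phi0 ->; rewrite subrr.
Qed.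

(** The boundary of b(w) :: z is z - b(w) :: d z, here with z = F w - D(d w).  By
    induction d D(d w) = F(d w) - D(d d w) = F(d w), hence z is a cycle and the
    second term vanishes. *)
Lemma cone_homotopy_coboundary phi w :
  D (d phi) w = F phi w - d (D phi) w.
Proof.
elim/size_induction: w phi => -[|x w] IHw phi.
  by rewrite F_nil subr0.
rewrite cone_homotopy_cons //; pose c := cone (b (x :: w)) phi.
rewrite (F_local (psi := fun l => phi l - d c l)) // FB F_coboundary.
transitivity (F phi (x :: w) - d (F c) (x :: w) - (d (D phi) (x :: w) - d (F c) (x :: w))).
  congr (_ - _); rewrite -[d (F c) _]subr0 -(list_coboundaryK (D c) (x :: w)) -2!list_coboundaryB.
  apply: eq_list_coboundary => l lw.
  rewrite -IHw ?lw // -cone_homotopyB.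
  by apply: eq_cone_homotopy.
by rewrite subrACA subrr subr0.
Qed.

End ConeHomotopy.

(** Naturality: the homotopy commutes with every pair of maps that carries apexes
    to apexes and commutes with [F].  This lets one compute it on the standard
    simplex alone and transport it along singular simplices. *)
Lemma cone_homotopy_map V V' W W' (b : seq V -> W) (b' : seq V' -> W')
    (F : (seq W -> A) -> seq V -> A) (F' : (seq W' -> A) -> seq V' -> A)
    (g : V -> V') (h : W -> W') phi w :
  (forall phi' psi' w', (forall l, size l = size w' -> phi' l = psi' l) ->
     F phi' w' = F psi' w') ->
  (forall l, (0 < size l)%N -> b' (map g l) = h (b l)) ->
  (forall phi' l, F' phi' (map g l) = F (phi' \o map h) l) ->
  cone_homotopy b' F' phi (map g w) = cone_homotopy b F (phi \o map h) w.
Proof.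
move=> eqF bgh FF'; elim/size_induction: w phi => -[|x w] IHw phi //.
rewrite !cone_homotopy_cons ?size_map // bgh // FF' list_coboundary_map.
congr (_ - _); apply: eq_list_coboundary => l lw.
by rewrite /= IHw ?lw.
Qed.

End ListCochains.

Definition delete V k (l : seq V) := take k l ++ drop k.+1 l.

Lemma size_delete V k (l : seq V) : (k < size l)%N -> size (delete k l) = (size l).-1.
Proof. by move=> kl; rewrite size_cat size_take kl size_drop; lia. Qed.

Lemma nth_delete V (x : V) k l j : nth x (delete k l) j = nth x l (bump k j).
Proof.
rewrite nth_cat size_take; case: (ltnP k (size l)) => kl; last first.
  rewrite take_oversize // /bump.
  case: ltnP => [jl|lj]; first by rewrite leqNgt (leq_trans jl).
  by rewrite nth_default ?size_drop ?nth_default //; lia.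
rewrite /bump; case: (ltnP j k) => jk; first by rewrite nth_take // jk.
by rewrite nth_drop; congr (nth _ _ _); lia.
Qed.

Lemma map_delete V W (g : V -> W) k l : map g (delete k l) = delete k (map g l).
Proof. by rewrite map_cat map_take map_drop. Qed.

Lemma list_coboundaryE (A : pzRingType) V (phi : seq V -> A) l :
  list_coboundary phi l = \sum_(k < size l) (-1) ^+ k * phi (delete k l).
Proof.
elim: l phi => [|x l IHl] phi /=; first by rewrite big_ord0.
rewrite big_ord_recl mul1r /delete /= drop0 IHl -sumrN; congr (_ + _).
by apply: eq_bigr => k _; rewrite /bump /= add1n exprS mulN1r mulNr.
Qed.

(** * Affine simplices *)

Section Affine.
Context {R : realType}.
Local Notation simplex n := (@std_simplex R n).

Definition bcoord n (t : simplex n) (k : 'I_n.+1) : R := set_val t 0 k.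

Lemma bcoord_ge0 n (t : simplex n) k : 0 <= bcoord t k.
Proof. by case: t => t tP; rewrite /bcoord set_valE /=; move: tP; rewrite inE => -[]. Qed.

Lemma bcoord_sum n (t : simplex n) : \sum_k bcoord t k = 1.
Proof. by case: t => t tP; rewrite /bcoord set_valE /=; move: tP; rewrite inE => -[]. Qed.

Lemma bcoord_le1 n (t : simplex n) k : bcoord t k <= 1.
Proof.
rewrite -(bcoord_sum t) (bigD1 k) //= lerDl sumr_ge0 // => j _; exact: bcoord_ge0.
Qed.

Lemma bcoordP n (t u : simplex n) : (forall k, bcoord t k = bcoord u k) -> t = u.
Proof. by move=> tu; apply: val_inj; apply/rowP => k; exact: tu. Qed.

Lemma row_continuous (T : topologicalType) n (f : T -> 'rV[R]_n) :
  (forall k, continuous (fun t => f t 0 k)) -> continuous f.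
Proof.
move=> fk t B [P tP PB].
have Ft : Filter (nbhs t) by exact: nbhs_filter.
have : \forall s \near t, forall i j, P i j (f s i j).
  apply: (filter_forall (f := fun i s => forall j, P i j (f s i j)) Ft _) => i.
  apply: (filter_forall (f := fun j s => P i j (f s i j)) Ft _) => j.
  by rewrite (ord1 i); apply: (fk j t); rewrite -(ord1 i); apply: tP.
by apply: filterS => s; exact: PB.
Qed.

Lemma simplex_continuous (T : topologicalType) n (f : T -> simplex n) :
  (forall k, continuous (fun t => bcoord (f t) k)) -> continuous f.
Proof.
move=> fk; apply: (@continuous_comp_initial (@std_simplex R n) T _ set_val).
exact: row_continuous.
Qed.

Lemma bcoord_continuous n k : continuous (fun t : simplex n => bcoord t k).
Proof.
move=> t; apply: (@continuous_comp _ _ _ set_val (fun x : 'rV[R]_n.+1 => x 0 k)).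
  exact: initial_continuous.
exact: coord_continuous.
Qed.

Lemma vertex_subproof n i : @std_simplex R n (delta_mx 0 (inord i)).
Proof.
split=> [k|]; first by rewrite mxE ler0n.
rewrite (bigD1 (inord i)) //= big1 => [|k /negPf ki]; rewrite mxE !eqxx ?addr0 //.
by rewrite ki.
Qed.

Definition vertex n i : simplex n := SigSub (mem_set (vertex_subproof n i)).

Lemma bcoord_vertex n i k : bcoord (vertex n i) k = (k == inord i)%:R.
Proof. by rewrite /bcoord set_valE /= mxE eqxx. Qed.

(** The default vertex is never read when [l] has [m.+1] entries, which is the
    only case of interest. *)
Definition affine_row m n (l : seq (simplex n)) (t : simplex m) : 'rV[R]_n.+1 :=
  \row_k \sum_(j < m.+1) bcoord t j * bcoord (nth (vertex n 0) l j) k.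

Lemma affine_subproof m n (l : seq (simplex n)) (t : simplex m) :
  @std_simplex R n (affine_row l t).
Proof.
split=> [k|]; first by rewrite mxE sumr_ge0 // => j _; rewrite mulr_ge0 ?bcoord_ge0.
under eq_bigr do rewrite mxE.
rewrite exchange_big /= -[RHS](bcoord_sum t); apply: eq_bigr => j _.
by rewrite -mulr_sumr bcoord_sum mulr1.
Qed.

Definition affine m n (l : seq (simplex n)) (t : simplex m) : simplex n :=
  SigSub (mem_set (affine_subproof l t)).

Lemma bcoord_affine m n (l : seq (simplex n)) (t : simplex m) k :
  bcoord (affine l t) k = \sum_(j < m.+1) bcoord t j * bcoord (nth (vertex n 0) l j) k.
Proof. by rewrite /bcoord set_valE /= mxE. Qed.

Lemma affine_continuous m n (l : seq (simplex n)) : continuous (@affine m n l).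
Proof.
apply: simplex_continuous => k.
have -> : (fun t => bcoord (affine l t) k) = fun t : simplex m =>
    \sum_(j < m.+1) bcoord t j * bcoord (nth (vertex n 0) l j) k.
  by apply/funext => t; rewrite bcoord_affine.
apply: continuous_big => [|j _]; first exact: add_continuous.
by move=> t; apply: cvgMr_tmp; [exact: nbhs_filter | exact: bcoord_continuous].
Qed.

HB.instance Definition _ m n l :=
  isContinuous.Build _ _ (@affine m n l) (@affine_continuous m n l).

Lemma affine_vertex m n (l : seq (simplex n)) i : (i <= m)%N ->
  affine l (vertex m i) = nth (vertex n 0) l i.
Proof.
move=> im; apply: bcoordP => k; rewrite bcoord_affine (bigD1 (inord i)) //= big1.
  by rewrite bcoord_vertex eqxx mul1r addr0 inordK.
by move=> j /negPf ji; rewrite bcoord_vertex ji mul0r.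
Qed.

Lemma affine_affine p m n (w : seq (simplex n)) (l : seq (simplex m)) (t : simplex p) :
  (p < size l)%N -> affine w (affine l t) = affine [seq affine w x | x <- l] t.
Proof.
move=> pl; apply: bcoordP => k; rewrite !bcoord_affine.
under eq_bigr => j _ do rewrite bcoord_affine mulr_suml.
rewrite exchange_big; apply: eq_bigr => i _ /=.
rewrite (nth_map (vertex m 0)); last by apply: leq_trans pl; exact: ltn_ord.
by rewrite bcoord_affine mulr_sumr; apply: eq_bigr => j _; rewrite mulrA.
Qed.

Definition vertices n : seq (simplex n) := [seq vertex n i | i <- iota 0 n.+1].

Arguments vertices : simpl never.

Lemma size_vertices n : size (vertices n) = n.+1.
Proof. by rewrite size_map size_iota. Qed.

Lemma nth_vertices n x i : (i <= n)%N -> nth x (vertices n) i = vertex n i.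
Proof. by move=> ni; rewrite (nth_map 0%N) ?size_iota // nth_iota. Qed.

Lemma map_affine_vertices m n (l : seq (simplex n)) : size l = m.+1 ->
  [seq affine l x | x <- vertices m] = l.
Proof.
move=> lm; apply: (@eq_from_nth _ (vertex n 0)) => [|i].
  by rewrite size_map size_vertices.
rewrite size_map size_vertices => im.
by rewrite (nth_map (vertex m 0)) ?size_vertices // nth_vertices // affine_vertex.
Qed.

Lemma affine_vertices n (t : simplex n) : affine (vertices n) t = t.
Proof.
apply: bcoordP => k; rewrite bcoord_affine (bigD1 k) //= big1 => [|j jk].
  by rewrite nth_vertices -1?ltnS // bcoord_vertex inord_val eqxx mulr1 addr0.
by rewrite nth_vertices -1?ltnS // bcoord_vertex inord_val eq_sym (negPf jk) mulr0.
Qed.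

Lemma affine_bump m n (l : seq (simplex n)) k (t : simplex m) : (k < m.+2)%N ->
  affine l (simplex_map m.+1 (bump k) t) = affine (delete k l) t.
Proof.
move=> km; apply: bcoordP => i; rewrite !bcoord_affine.
under eq_bigr => j _ do rewrite /bcoord set_valE /= mxE mulr_suml.
rewrite (exchange_big_dep xpredT) //=; apply: eq_bigr => j _.
rewrite (big_pred1 (inord (bump k j))) => [|h]; last by rewrite /= eq_sym.
by rewrite nth_delete inordK // /bump; have := ltn_ord j; case: (k <= j)%N; lia.
Qed.

End Affine.

(** * Barycentric subdivision and its mesh *)

Section Subdivision.
Context {R : realType}.
Local Notation simplex n := (@std_simplex R n).

Lemma centroid_subproof n : @std_simplex R n (const_mx n.+1%:R^-1).
Proof.
split=> [k|]; first by rewrite mxE invr_ge0 ler0n.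
under eq_bigr do rewrite mxE.
by rewrite sumr_const card_ord -[_ *+ _]mulr_natr mulVf // pnatr_eq0.
Qed.

Definition centroid n : simplex n := SigSub (mem_set (centroid_subproof n)).

Definition barycenter n (l : seq (simplex n)) : simplex n :=
  affine l (centroid (size l).-1).

Lemma barycenter_affine m n (w : seq (simplex n)) (l : seq (simplex m)) :
  (0 < size l)%N -> barycenter (map (affine w) l) = affine w (barycenter l).
Proof.
by case: l => // x l _; rewrite /barycenter size_map affine_affine.
Qed.

Lemma bcoord_barycenter n (l : seq (simplex n)) k : (0 < size l)%N ->
  bcoord (barycenter l) k = (\sum_(x <- l) bcoord x k) / (size l)%:R.
Proof.
case: l => // x l _; rewrite bcoord_affine (big_nth (vertex n 0)) big_mkord mulr_suml.
by apply: eq_bigr => j _; rewrite {1}/bcoord set_valE /= mxE mulrC.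
Qed.

(** Closeness in the supremum norm of the ambient space. *)
Definition close (r : R) n (x y : simplex n) :=
  forall k, `|bcoord x k - bcoord y k| <= r.

Lemma close_sym r n (x y : simplex n) : close r x y -> close r y x.
Proof. by move=> xy k; rewrite distrC. Qed.

Lemma barycenter_dist n (l : seq (simplex n)) z k : (0 < size l)%N ->
  `|z - bcoord (barycenter l) k| <= (\sum_(x <- l) `|z - bcoord x k|) / (size l)%:R.
Proof.
move=> l0; have p0 : 0 < (size l)%:R :> R by rewrite ltr0n.
have pz : z = \sum_(x <- l) z / (size l)%:R.
  by rewrite -mulr_suml big_const_seq count_predT iter_addr_0 -[z *+ _]mulr_natr mulfK ?gt_eqF.
rewrite bcoord_barycenter // [X in `|X - _|]pz -mulr_suml -mulrBl normrM.
rewrite [`|_^-1|]gtr0_norm ?invr_gt0 // ler_pM2r ?invr_gt0 //.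
by rewrite -sumrB ler_norm_sum.
Qed.

Lemma barycenter_close n (l : seq (simplex n)) z r : (0 < size l)%N ->
  {in l, forall x, close r z x} -> close r z (barycenter l).
Proof.
move=> l0 lr k; apply: le_trans (barycenter_dist _ _ l0) _.
rewrite ler_pdivrMr ?ltr0n //.
apply: (@le_trans _ _ (\sum_(x <- l) r)).
  by rewrite big_seq [leRHS]big_seq; apply: ler_sum => x xl; exact: lr.
by rewrite big_const_seq count_predT iter_addr_0 mulr_natr.
Qed.

Definition mesh_le (d : R) n (l : seq (simplex n)) :=
  {in l &, forall x y, close d x y}.

Definition shrink N : R := N%:R / N.+1%:R.

(** The summand of [y] itself vanishes in the average of the distances to [y],
    which leaves p - 1 terms out of p; and (p - 1)/p increases with p.  The bound
    through [N] gives one contraction factor for all the dimensions at most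
    [N]. *)
Lemma barycenter_mesh N n (l : seq (simplex n)) d y : 0 <= d -> (size l <= N.+1)%N ->
  mesh_le d l -> y \in l -> close (shrink N * d) (barycenter l) y.
Proof.
move=> d0 lN ld yl; apply: close_sym => k.
have l0 : (0 < size l)%N by case: (l) yl.
apply: le_trans (barycenter_dist _ _ l0) _.
rewrite (big_rem y) //= subrr normr0 add0r.
apply: (@le_trans _ _ ((\sum_(x <- rem y l) d) / (size l)%:R)).
  rewrite ler_pM2r ?invr_gt0 ?ltr0n //.
  rewrite big_seq [leRHS]big_seq; apply: ler_sum => x /mem_rem xl; exact: ld.
rewrite big_const_seq count_predT iter_addr_0 size_rem // -[d *+ _]mulr_natr.
rewrite -mulrA [leRHS]mulrC ler_wpM2l // /shrink.
case: (size l) l0 lN => // p _ pN /=.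
rewrite ler_pdivrMr ?ltr0n // mulrAC ler_pdivlMr ?ltr0n // -!natrM ler_nat.
by lia.
Qed.

(** The simplices of the subdivision of [w] lie in the convex hull of [w] and are
    smaller than [w] by a constant factor.  The statement is dual: it lists which
    values of [phi] can matter.  The convex hull enters only through the balls
    that contain [w], which is enough to bound the distance between a new
    barycenter and the older vertices. *)
Lemma subdivide_mesh (A : pzRingType) N n (phi : seq (simplex n) -> A) d w :
  0 <= d -> (size w <= N.+1)%N -> mesh_le d w ->
  (forall l, size l = size w ->
     (forall z r, {in w, forall x, close r z x} -> {in l, forall x, close r z x}) ->
     mesh_le (shrink N * d) l -> phi l = 0) ->
  subdivide (@barycenter n) phi w = 0.
Proof.
move=> d0; have cd0 : 0 <= shrink N * d by rewrite mulr_ge0 // divr_ge0 ?ler0n.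
elim/size_induction: w phi => w IHw phi wN wd phi0.
case: (posnP (size w)) => [/size0nil w0|w_gt0].
  by subst w; exact: phi0.
rewrite subdivide_cons // list_coboundaryE big1 // => k _.
have sub_w : {subset delete k w <= w}.
  by move=> x; rewrite mem_cat => /orP[/mem_take|/mem_drop].
have size_w : size (delete k w) = (size w).-1 by exact: size_delete.
rewrite IHw ?mulr0 //; [by rewrite size_w; lia|by rewrite size_w; lia| |].
  by move=> x y /sub_w xw /sub_w yw; exact: wd.
move=> l lw l_hull l_mesh; apply: phi0 => [|z r zr x|].
- by rewrite /= lw size_w; lia.
- rewrite in_cons => /orP[/eqP ->|]; first exact: barycenter_close.
  by apply: l_hull => y /sub_w; exact: zr.
have b_l : {in l, forall x, close (shrink N * d) (barycenter w) x}.
  by apply: l_hull => y /sub_w yw; exact: barycenter_mesh.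
move=> x y; rewrite !in_cons => /orP[/eqP->|xl] /orP[/eqP->|yl].
- by move=> i; rewrite subrr normr0.
- exact: b_l.
- by apply: close_sym; exact: b_l.
- exact: l_mesh.
Qed.

Lemma shrink_ge0 N : 0 <= shrink N.
Proof. by rewrite divr_ge0 ?ler0n. Qed.

Lemma shrink_lt1 N : shrink N < 1.
Proof. by rewrite ltr_pdivrMr ?ltr0n // mul1r ltr_nat. Qed.

Lemma iter_subdivide_mesh (A : pzRingType) N n (phi : seq (simplex n) -> A) d w i :
  0 <= d -> (size w <= N.+1)%N -> mesh_le d w ->
  (forall l, size l = size w -> mesh_le (shrink N ^+ i * d) l -> phi l = 0) ->
  iter i (subdivide (@barycenter n)) phi w = 0.
Proof.
elim: i d w => [|i IHi] d w d0 wN wd phi0 /=.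
  by apply: phi0 => //; rewrite expr0 mul1r.
apply: (subdivide_mesh d0 wN wd) => l lw _ ld.
apply: (IHi (shrink N * d)); rewrite ?lw ?mulr_ge0 ?shrink_ge0 // => l' l'l l'd.
by apply: phi0; rewrite ?l'l // exprSr -mulrA.
Qed.

Lemma mesh_le1 n (l : seq (simplex n)) : mesh_le 1 l.
Proof.
move=> x y _ _ k; have := bcoord_ge0 x k; have := bcoord_ge0 y k.
by have := bcoord_le1 x k; have := bcoord_le1 y k; rewrite ler_norml; lra.
Qed.

Lemma affine_close m n (l : seq (simplex n)) (t : simplex m) z r :
  size l = m.+1 -> {in l, forall x, close r z x} -> close r z (affine l t).
Proof.
move=> lm lr k; rewrite bcoord_affine.
have -> : bcoord z k = \sum_(j < m.+1) bcoord t j * bcoord z k.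
  by rewrite -mulr_suml bcoord_sum mul1r.
rewrite -sumrB; apply: le_trans (ler_norm_sum _ _ _) _.
apply: (@le_trans _ _ (\sum_(j < m.+1) bcoord t j * r)); last first.
  by rewrite -mulr_suml bcoord_sum mul1r.
apply: ler_sum => j _; rewrite -mulrBr normrM ger0_norm ?bcoord_ge0 //.
by rewrite ler_wpM2l ?bcoord_ge0 // lr // mem_nth // lm.
Qed.

(** A closed subset of a cube. *)
Lemma std_simplex_compact n : compact (@std_simplex R n).
Proof.
have -> : @std_simplex R n = [set x : 'rV[R]_n.+1 | forall i, x 0 i \in `[0, 1]] `&`
    (fun x : 'rV[R]_n.+1 => \sum_i x 0 i) @^-1` [set 1].
  apply/seteqP; split => [x [x0 x1]|x [/= x01 x1]]; split => // i.
    rewrite /= in_itv /= x0 -x1 (bigD1 i) //= lerDl.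
    by rewrite sumr_ge0.
  by have := x01 i; rewrite in_itv => /andP[].
apply: compact_closedI.
  apply: (@rV_compact R n.+1 (fun=> `[0, 1]%classic)) => i.
  exact: segment_compact.
apply: preimage_closed; last exact: closed_eq.
move=> x _; apply: continuous_big => [|j _]; first exact: add_continuous.
exact: coord_continuous.
Qed.

(** The Lebesgue number of the cover pulled back to the compact simplex.  If
    the ball of radius e about x maps into one [U i], every radius below e/2
    works at all points within e/2 of x; compactness then gives a radius that
    works everywhere. *)
Lemma lebesgue_number (X : topologicalType) (I : Type) (U : I -> set X) n
    (s : simplex n -> X) :
  (forall i, open (U i)) -> (forall x, exists i, U i x) -> continuous s ->
  exists2 e : R, 0 < e & forall x, exists i, forall y, close e x y -> U i (s y).
Proof.
move=> U_open U_cover s_cont.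
pose P (e : R) (x : 'rV[R]_n.+1) := exists i, forall y : simplex n,
  (forall k, `|x 0 k - bcoord y k| <= e) -> U i (s y).
have : \forall e \near 0^'+, @std_simplex R n `<=` P e.
  apply: (iffLR (compact_near_coveringP _) (@std_simplex_compact n) R 0^'+ P _).
  move=> x Kx; have [i Ui] := U_cover (s (SigSub (mem_set Kx))).
  have : nbhs (SigSub (mem_set Kx) : simplex n) (s @^-1` U i).
    by apply: s_cont; apply: open_nbhs_nbhs; split => //; exact: U_open.
  move=> [B [[W W_open <-] Wx WU]].
  have /nbhs_ballP[e e0 eW] : nbhs x W by apply: open_nbhs_nbhs; split.
  exists (ball x (e / 2), [set d | d < e / 2]).
    split => /=; first by apply: nbhsx_ballx; rewrite divr_gt0.
    by apply: nbhs_right_lt; rewrite divr_gt0.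
  move=> [x' d] [/= [_ xx'] de]; exists i => y x'y; apply: WU.
  apply: eW; split=> // j k; rewrite (ord1 j).
  have := xx' 0 k; have := x'y k; rewrite /ball /= -/(bcoord y k) => H1 H2.
  have -> : x 0 k - bcoord y k = (x 0 k - x' 0 k) + (x' 0 k - bcoord y k) by ring.
  apply: le_lt_trans (ler_normD _ _) _; lra.
move=> Pnear; have : \forall e \near 0^'+, 0 < e /\ @std_simplex R n `<=` P e.
  by apply: filterI => //; exact: nbhs_right_gt.
move=> /filter_ex[e [e0 eP]]; exists e => // x.
have [|i iU] := eP (set_val x); first exact: set_mem (valP x).
by exists i => y xy; apply: iU.
Qed.

End Subdivision.

(** * From functions on lists to singular cochains *)

Section Realisation.
Context {R : realType} {A : comPzRingType} {X : topologicalType} {V : Type}.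
Variable rho : forall m, seq V -> singular R X m.
Implicit Types a : cochain R A X.

(** The value 0 on the empty list corresponds to the convention that the
    coboundary of a cochain vanishes in degree 0. *)
Definition evaluate a (l : seq V) : A :=
  if l is _ :: l' then a (size l') (rho (size l') l) else 0.

Lemma evaluateE a m l : size l = m.+1 -> evaluate a l = a m (rho m l).
Proof. by case: l => // x l [<-]. Qed.

Lemma evaluate_coboundary a l :
  (forall m l' k, size l' = m.+2 -> (k < m.+2)%N ->
     face (rho m.+1 l') m (bump k) = rho m (delete k l')) ->
  list_coboundary (evaluate a) l = evaluate (coboundary a) l.
Proof.
move=> rho_face; rewrite list_coboundaryE.
case sl: (size l) => [|[|m]].
- by rewrite big_ord0; case: l sl.
- by rewrite (evaluateE _ sl) big_ord1; case: l sl => [|x []] // _; rewrite mulr0.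
rewrite (evaluateE _ sl); apply: eq_bigr => k _.
by rewrite rho_face // (@evaluateE _ m) // size_delete sl.
Qed.

End Realisation.

Section Transfer.
Context {R : realType} {A : comPzRingType} {X : topologicalType}.
Local Notation simplex n := (@std_simplex R n).
Implicit Types (a : cochain R A X).

Definition affine_face n (s : singular R X n) m (l : seq (simplex n)) :
  singular R X m := s \o affine l.

Lemma affine_face_bump n (s : singular R X n) m l k : (k < m.+2)%N ->
  face (affine_face s m.+1 l) m (bump k) = affine_face s m (delete k l).
Proof. by move=> km; apply/continuousEP => t /=; rewrite affine_bump. Qed.

Lemma affine_face_vertices n (s : singular R X n) : affine_face s n (vertices n) = s.
Proof. by apply/continuousEP => t /=; rewrite affine_vertices. Qed.

Lemma affine_face_affine p m n (s : singular R X n) w (l : seq (simplex m)) :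
  (p < size l)%N ->
  affine_face (affine_face s m w) p l = affine_face s p [seq affine w x | x <- l].
Proof. by move=> pl; apply/continuousEP => t /=; rewrite affine_affine. Qed.

Definition list_values n (s : singular R X n) a : seq (simplex n) -> A :=
  evaluate (affine_face s) a.

Lemma list_values_vertices n (s : singular R X n) a :
  list_values s a (vertices n) = a n s.
Proof. by rewrite /list_values (evaluateE _ _ (size_vertices _)) affine_face_vertices. Qed.

Lemma list_values_coboundary n (s : singular R X n) a l :
  list_coboundary (list_values s a) l = list_values s (coboundary a) l.
Proof. by apply: evaluate_coboundary => m l' k _; exact: affine_face_bump. Qed.

Lemma list_values_affine m n (s : singular R X n) a w (l : seq (simplex m)) :
  list_values (affine_face s m w) a l = list_values s a [seq affine w x | x <- l].
Proof.
case: l => // x l; rewrite /list_values /evaluate map_cons size_map.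
by rewrite affine_face_affine.
Qed.

(** A family of functions on lists that is natural for affine maps is determined
    by its values on the lists of all vertices, that is, by a cochain.  Thus
    identities between natural operators on lists become identities between
    operators on cochains, and such operators can be iterated. *)
Lemma list_values_natural (G : forall n, singular R X n -> seq (simplex n) -> A) :
  (forall n s, G n s [::] = 0) ->
  (forall m n (s : singular R X n) w l,
     G m (affine_face s m w) l = G n s [seq affine w x | x <- l]) ->
  forall n (s : singular R X n),
    list_values s (fun n s => G n s (vertices n)) = G n s.
Proof.
move=> G0 G_affine n s; apply/funext => -[|x l]; first by rewrite G0.
rewrite {1}/list_values (@evaluateE _ _ _ _ _ _ (size l)) // G_affine.
by rewrite map_affine_vertices.
Qed.

End Transfer.

(** * Cocycles that vanish on small simplices *)

Section SmallSimplices.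
Context {R : realType} {A : comPzRingType} {X : topologicalType}.
Local Notation simplex n := (@std_simplex R n).
Implicit Types (a : cochain R A X).

Definition list_subdivision n : (seq (simplex n) -> A) -> seq (simplex n) -> A :=
  subdivide (@barycenter R n).

Definition list_subdivision_homotopy n :
    (seq (simplex n) -> A) -> seq (simplex n) -> A :=
  cone_homotopy (@barycenter R n) (fun phi w => phi w - list_subdivision phi w).

Definition subdivision a : cochain R A X :=
  fun n s => list_subdivision (list_values s a) (vertices n).

Definition subdivision_homotopy a : cochain R A X :=
  fun n s => list_subdivision_homotopy (list_values s a) (vertices n).

Lemma list_values_affineE m n (s : singular R X n) a w :
  list_values (affine_face s m w) a = list_values s a \o map (affine w).
Proof. by apply/funext => l; exact: list_values_affine. Qed.

Lemma list_subdivision_affine m n (w : seq (simplex n)) phi (l : seq (simplex m)) :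
  list_subdivision (phi \o map (affine w)) l =
  list_subdivision phi [seq affine w x | x <- l].
Proof.
rewrite /list_subdivision (subdivide_map (bV := @barycenter R m)) // => l' l'0.
exact: barycenter_affine.
Qed.

Lemma list_subdivision_local n phi psi (w : seq (simplex n)) :
  (forall l, size l = size w -> phi l = psi l) ->
  phi w - list_subdivision phi w = psi w - list_subdivision psi w.
Proof.
by move=> phipsi; rewrite phipsi // /list_subdivision (eq_subdivide _ phipsi).
Qed.

Lemma list_values_subdivision n (s : singular R X n) a :
  list_values s (subdivision a) = list_subdivision (list_values s a).
Proof.
apply: (list_values_natural
  (G := fun n s => list_subdivision (list_values s a))) => // m p t w l.
by rewrite list_values_affineE list_subdivision_affine.
Qed.

Lemma list_values_subdivision_homotopy n (s : singular R X n) a :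
  list_values s (subdivision_homotopy a) =
  list_subdivision_homotopy (list_values s a).
Proof.
apply: (list_values_natural
  (G := fun n s => list_subdivision_homotopy (list_values s a))) => // m p t w l.
rewrite list_values_affineE; apply/esym/cone_homotopy_map => [phi psi w'|l'|phi l'].
- exact: list_subdivision_local.
- exact: barycenter_affine.
- by rewrite list_subdivision_affine.
Qed.

Lemma coboundary_subdivision_homotopy a :
  coboundary (subdivision_homotopy a) =
  a - subdivision a - subdivision_homotopy (coboundary a).
Proof.
apply: cochainP => n s; rewrite -list_values_vertices -list_values_coboundary.
rewrite list_values_subdivision_homotopy !cochainBE.
rewrite -[a n s]list_values_vertices -[subdivision a s]list_values_vertices.
rewrite list_values_subdivision.
rewrite -[subdivision_homotopy (coboundary a) s]list_values_vertices.
rewrite list_values_subdivision_homotopy.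
have -> : list_values s (coboundary a) = list_coboundary (list_values s a).
  by apply/funext => l; rewrite list_values_coboundary.
rewrite /list_subdivision_homotopy cone_homotopy_coboundary; cbv beta.
- by rewrite subKr.
- by move=> phi psi w; rewrite /list_subdivision subdivideB subrACA.
- by move=> phi w; rewrite /list_subdivision subdivide_coboundary list_coboundaryB.
- exact: list_subdivision_local.
- by move=> phi; rewrite subrr.
Qed.

Lemma coboundary_subdivision a :
  coboundary (subdivision a) = subdivision (coboundary a).
Proof.
apply: cochainP => n s; rewrite -list_values_vertices -list_values_coboundary.
rewrite list_values_subdivision /list_subdivision -subdivide_coboundary.
by apply: eq_subdivide => l _; exact: list_values_coboundary.
Qed.

Lemma list_values0 n (s : singular R X n) l : list_values s (0 : cochain R A X) l = 0.
Proof. by case: l. Qed.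

Lemma subdivision0 : subdivision (0 : cochain R A X) = 0.
Proof.
apply: cochainP => n s; rewrite -[LHS]list_values_vertices list_values_subdivision.
rewrite -[RHS](subrr (list_subdivision (list_values s 0) (vertices n))) -subdivideB.
by apply: eq_subdivide => l _; rewrite list_values0 subrr.
Qed.

Lemma subdivision_homotopy0 n (s : singular R X n) a :
  (forall l, size l = n.+2 -> list_values s a l = 0) ->
  subdivision_homotopy a s = 0.
Proof.
move=> a0; apply: cone_homotopy_eq0 => [phi psi w|phi psi w|l].
- by rewrite /list_subdivision subdivideB subrACA.
- exact: list_subdivision_local.
- by rewrite size_vertices => /a0.
Qed.

Lemma list_values_iter_subdivision n (s : singular R X n) a i :
  list_values s (iter i subdivision a) = iter i (@list_subdivision n) (list_values s a).
Proof. by elim: i => //= i IHi; rewrite list_values_subdivision IHi. Qed.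

Lemma coboundary_iter_subdivision a i :
  coboundary a = 0 -> coboundary (iter i subdivision a) = 0.
Proof.
by move=> a0; elim: i => //= i IHi; rewrite coboundary_subdivision IHi subdivision0.
Qed.

HB.instance Definition _ := GRing.isZmodMorphism.Build (cochain R A X)
  (cochain R A X) (@coboundary R A X) coboundaryB.

Lemma cochain_sumE m (F : nat -> cochain R A X) n (s : singular R X n) :
  (\sum_(i < m) F i) n s = \sum_(i < m) F i n s.
Proof.
by elim: m => [|m IHm]; rewrite ?big_ord0 // !big_ord_recr -IHm.
Qed.

Lemma coboundary_sum_subdivision_homotopy a m : coboundary a = 0 ->
  coboundary (\sum_(i < m) subdivision_homotopy (iter i subdivision a)) =
  a - iter m subdivision a.
Proof.
move=> a0; elim: m => [|m IHm]; first by rewrite big_ord0 raddf0 subrr.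
rewrite big_ord_recr raddfD /= IHm coboundary_subdivision_homotopy.
rewrite coboundary_iter_subdivision //.
have -> : subdivision_homotopy (0 : cochain R A X) = 0.
  apply: cochainP => n s; apply: subdivision_homotopy0 => l _; exact: list_values0.
by rewrite subr0 addrA subrK.
Qed.

Variables (I : Type) (U : I -> set X).
Hypothesis U_open : forall i, open (U i).
Hypothesis U_cover : forall x, exists i, U i x.

Definition vanishes_within (S : set X) a :=
  forall n (s : singular R X n), range s `<=` S -> a n s = 0.

Lemma list_values_small a n (s : singular R X n) :
  (forall i, vanishes_within (U i) a) ->
  exists2 e : R, 0 < e & forall l, mesh_le e l -> list_values s a l = 0.
Proof.
move=> a_small.
have [e e0 eU] := lebesgue_number U_open U_cover (@cts_fun _ _ s).
exists e => // -[//|x l] le; have [i iU] := eU x; apply: (a_small i) => _ [t _ <-] /=.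
apply/iU/affine_close => // y yl; apply: le => //; exact: mem_head.
Qed.

(** The bound [n.+2] covers both the simplex [s] itself and the simplices of
    dimension one more on which the subdivision homotopy evaluates a cochain. *)
Lemma iter_subdivision_small a n (s : singular R X n) :
  (forall i, vanishes_within (U i) a) ->
  exists M, forall i, (M <= i)%N -> forall l, (size l <= n.+2)%N ->
    list_values s (iter i subdivision a) l = 0.
Proof.
move=> /(list_values_small s)[e e0 a0].
have : \forall i \near \oo, shrink n.+1 ^+ i < e :> R.
  have := @cvg_expr R (shrink n.+1).
  rewrite ger0_norm ?shrink_ge0 // => /(_ (shrink_lt1 _)) /cvgr_lt; exact.
move=> [M _ Me]; exists M => i Mi l ln; rewrite list_values_iter_subdivision.
apply: (@iter_subdivide_mesh _ _ n.+1 _ _ 1) => // [|l' _ l'e]; first exact: mesh_le1.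
apply: a0 => x y xl yl k; apply: le_trans (l'e x y xl yl k) _.
by rewrite mulr1 ltW //; exact: Me.
Qed.

(** Writing S for the subdivision and T for its homotopy, a - S^m a is the
    coboundary of the sum of the T S^i a for i < m.  As [a] vanishes on small
    simplices, S^i a vanishes, in any fixed dimension, on the affine simplices
    inside a given singular simplex once i is large.  The infinite sum of the T S^i a is therefore finite on each singular
    simplex, and its coboundary is [a]. *)
Theorem small_cocycle_coboundary a : finitely_graded a -> coboundary a = 0 ->
  (forall i, vanishes_within (U i) a) ->
  exists2 e : cochain R A X, finitely_graded e & a = coboundary e.
Proof.
move=> [N aN] a_cocycle a_small.
pose D i := subdivision_homotopy (iter i subdivision a).
have M_ n (s : singular R X n) := cid (iter_subdivision_small s a_small).
pose M n s := projT1 (M_ n s).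
have MP n s i l := projT2 (M_ n s) i ^~ l.
pose e : cochain R A X := fun n s => \sum_(i < M n s) D i n s.
have eE n s m : (M n s <= m)%N -> e n s = (\sum_(i < m) D i) n s.
  move=> Mm; rewrite cochain_sumE /e -!(big_mkord xpredT (fun i => D i n s)).
  rewrite [RHS](@big_cat_nat _ _ _ (M n s)) //= [X in _ + X]big_nat [X in _ + X]big1 ?addr0 //.
  move=> i /andP[Mi _]; apply: subdivision_homotopy0 => l ln.
  by apply: (MP n s); rewrite ?ln.
exists e.
  (* T raises the dimension by one, so only the values of S^i a in degree n + 1
     matter here, and S^i preserves the degree *)
  exists N => n s Nn; rewrite /e big1 // => i _; apply: subdivision_homotopy0 => l ln.
  rewrite list_values_iter_subdivision.
  apply: (@iter_subdivide_mesh _ _ n.+1 _ _ 1) => [//|||l' l'l _].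
  - by rewrite ln.
  - exact: mesh_le1.
  - rewrite /list_values (@evaluateE _ _ _ _ _ _ n.+1) ?l'l ?ln //.
    exact/aN/leqW.
apply: cochainP => n s.
(* one finite sum has to compute [e] on all the faces of [s] at once *)
pose face_bound n : singular R X n -> nat :=
  if n is p.+1 then fun s => (\max_(k < p.+2) M p (face s p (bump k)))%N else fun=> 0%N.
pose m := maxn (M n s) (face_bound n s).
have -> : coboundary e s = coboundary (\sum_(i < m) D i) s.
  rewrite {}/m; case: n s => // p s; apply: eq_bigr => k _.
  rewrite (eE _ _ (maxn (M p.+1 s) (face_bound p.+1 s))) //.
  apply: leq_trans (leq_maxr _ _).
  exact: (leq_bigmax_cond (F := fun k : 'I_p.+2 => M p (face s p (bump k)))).
rewrite coboundary_sum_subdivision_homotopy // cochainBE.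
rewrite -(list_values_vertices s (iter _ _ _)) (MP n s) ?subr0 ?leq_maxl //.
by rewrite size_vertices.
Qed.

End SmallSimplices.

(** * Homotopy invariance *)

Definition bundle_continuous (X Y : topologicalType) (f : X -> Y)
    (fc : continuous f) : continuousType X Y :=
  HB.pack f (isContinuous.Build _ _ f fc).

Lemma pair_continuous (T X Y : topologicalType) (f : T -> X) (g : T -> Y) :
  continuous f -> continuous g -> continuous (fun t => (f t, g t)).
Proof. by move=> fc gc t; apply: cvg_pair; [exact: fc|exact: gc]. Qed.

Definition pairing (T X Y : topologicalType) (f : T -> X) (g : T -> Y) t := (f t, g t).

Lemma pairing_continuous (T X Y : topologicalType) (f : continuousType T X)
  (g : continuousType T Y) : continuous (pairing f g).
Proof. by apply: pair_continuous; exact: cts_fun. Qed.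

HB.instance Definition _ (T X Y : topologicalType) (f : continuousType T X)
  (g : continuousType T Y) :=
  isContinuous.Build _ _ (pairing f g) (@pairing_continuous T X Y f g).

Section Prism.
Context {R : realType} {A : comPzRingType} {X Y : topologicalType}.
Local Notation simplex n := (@std_simplex R n).
Local Notation I := (unit_interval R).
Variable h : continuousType (X * I)%type Y.
Implicit Types a : cochain R A Y.

Lemma edge_param_subproof (t : simplex 1) : unit_interval R (bcoord t ord_max).
Proof. by rewrite /unit_interval /= in_itv /= bcoord_ge0 bcoord_le1. Qed.

(** Using the 1-simplex in place of the interval makes a point of a prism a pair
    of points of standard simplices, so that affine simplices in a prism are
    pairs of affine simplices. *)
Definition edge_param (t : simplex 1) : I := SigSub (mem_set (edge_param_subproof t)).

Lemma edge_param_continuous : continuous edge_param.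
Proof.
apply: (@continuous_comp_initial I (simplex 1) _ set_val).
exact: bcoord_continuous.
Qed.

HB.instance Definition _ := isContinuous.Build _ _ edge_param edge_param_continuous.

Definition prism_face n (s : singular R X n) m (l : seq (simplex n * simplex 1)) :
    singular R Y m :=
  h \o pairing (s \o affine (unzip1 l)) (edge_param \o affine (unzip2 l)).

Lemma prism_face_bump n (s : singular R X n) m l k : (k < m.+2)%N ->
  face (prism_face s m.+1 l) m (bump k) = prism_face s m (delete k l).
Proof.
move=> km; apply/continuousEP => t /=.
by rewrite /pairing /= !affine_bump // /unzip1 /unzip2 !map_delete.
Qed.

Definition prism_values n (s : singular R X n) a := evaluate (prism_face s) a.

Lemma prism_values_coboundary n (s : singular R X n) a l :
  list_coboundary (prism_values s a) l = prism_values s (coboundary a) l.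
Proof. by apply: evaluate_coboundary => m l' k _; exact: prism_face_bump. Qed.

Definition move_base m n (w : seq (simplex n)) (x : simplex m * simplex 1) :=
  (affine w x.1, x.2).

Lemma prism_face_affine p m n (s : singular R X n) w
    (l : seq (simplex m * simplex 1)) : (p < size l)%N ->
  prism_face (affine_face s m w) p l = prism_face s p (map (move_base w) l).
Proof.
move=> pl; apply/continuousEP => t /=; rewrite /pairing /=.
by rewrite affine_affine ?size_map // /unzip1 /unzip2 -!map_comp.
Qed.

Lemma prism_values_affine m n (s : singular R X n) a w :
  prism_values (affine_face s m w) a = prism_values s a \o map (@move_base m n w).
Proof.
apply/funext => -[//|x l]; rewrite /prism_values /evaluate /= size_map.
by rewrite prism_face_affine.
Qed.

Definition end_difference n (phi : seq (simplex n * simplex 1) -> A)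
    (w : seq (simplex n)) :=
  phi [seq (x, vertex 1 1) | x <- w] - phi [seq (x, vertex 1 0) | x <- w].

(** Any point of the prism over the hull of [l] that is natural in [l] would do. *)
Definition prism_apex n (l : seq (simplex n)) := (barycenter l, @vertex R 1 0).

Definition list_prism n :=
  cone_homotopy (@prism_apex n) (@end_difference n).

Lemma end_difference_local n phi psi (w : seq (simplex n)) :
  (forall l, size l = size w -> phi l = psi l) ->
  end_difference phi w = end_difference psi w.
Proof. by move=> phipsi; rewrite /end_difference !phipsi ?size_map. Qed.

Definition prism a : cochain R A X :=
  fun n s => list_prism (prism_values s a) (vertices n).

Lemma list_values_prism n (s : singular R X n) a :
  list_values s (prism a) = list_prism (prism_values s a).
Proof.
apply: (list_values_natural
  (G := fun n s => list_prism (prism_values s a))) => // m p t w l.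
rewrite prism_values_affine.
apply/esym/cone_homotopy_map => [phi psi w'|l' l'0|phi l'].
- exact: end_difference_local.
- by rewrite /prism_apex barycenter_affine.
- by rewrite /end_difference /= -!map_comp.
Qed.

Lemma prism_face_end n (s : singular R X n) i (f : continuousType X Y) :
  (forall x, h (x, edge_param (vertex 1 i)) = f x) ->
  prism_face s n [seq (x, vertex 1 i) | x <- vertices n] = push_simplex f s.
Proof.
move=> hf; have map1 : unzip1 [seq (x, @vertex R 1 i) | x <- @vertices R n] = vertices n.
  by rewrite /unzip1 -map_comp map_id.
have map2 : unzip2 [seq (x, @vertex R 1 i) | x <- @vertices R n] =
    [seq vertex 1 i | x <- @vertices R n].
  by rewrite /unzip2 -map_comp.
have const_affine (t : simplex n) :
    affine [seq vertex 1 i | x <- @vertices R n] t = vertex 1 i :> simplex 1.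
  apply: bcoordP => k; rewrite bcoord_affine.
  transitivity (\sum_(j < n.+1) bcoord t j * bcoord (@vertex R 1 i) k).
    apply: eq_bigr => j _; congr (_ * bcoord _ k).
    by rewrite (nth_map (@vertex R n 0)) // size_vertices.
  by rewrite -mulr_suml bcoord_sum mul1r.
apply/continuousEP => t; rewrite /prism_face map1 map2.
transitivity (h (s (affine (@vertices R n) t),
  edge_param (affine [seq vertex 1 i | x <- @vertices R n] t))) => //.
by rewrite affine_vertices const_affine hf.
Qed.

Lemma prism_coboundary (f g : continuousType X Y) a :
  (forall x, h (x, edge_param (vertex 1 0)) = f x) ->
  (forall x, h (x, edge_param (vertex 1 1)) = g x) ->
  coboundary (prism a) = cochain_pull g a - cochain_pull f a - prism (coboundary a).
Proof.
move=> hf hg; apply: cochainP => n s; rewrite !cochainBE.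
rewrite -list_values_vertices -list_values_coboundary list_values_prism.
rewrite -[prism (coboundary a) s]list_values_vertices list_values_prism.
have -> : prism_values s (coboundary a) = list_coboundary (prism_values s a).
  by apply/funext => l; rewrite prism_values_coboundary.
rewrite /list_prism cone_homotopy_coboundary.
- rewrite {2}/end_difference /prism_values !(@evaluateE _ _ _ _ _ _ n) ?size_map ?size_iota //.
  by rewrite (prism_face_end s hf) (prism_face_end s hg) subKr.
- by move=> phi psi w; rewrite /end_difference subrACA.
- by move=> phi w; rewrite /end_difference !list_coboundary_map list_coboundaryB.
- exact: end_difference_local.
- by move=> phi; rewrite /end_difference subrr.
Qed.

Lemma prism_eq0 n (s : singular R X n) a :
  (forall t : singular R Y n.+1, a _ t = 0) -> prism a s = 0.
Proof.
move=> a0; apply: cone_homotopy_eq0 => [phi psi w|phi psi w|l].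
- by rewrite /end_difference subrACA.
- exact: end_difference_local.
- by rewrite size_vertices => ln; rewrite /prism_values (evaluateE _ _ ln).
Qed.

Lemma prism_finite a : finitely_graded a -> finitely_graded (prism a).
Proof.
by move=> [N aN]; exists N => n s Nn; apply: prism_eq0 => t; exact/aN/leqW.
Qed.

Lemma edge_param0 : edge_param (vertex 1 0) = I0 R.
Proof. by apply: val_inj; rewrite /= bcoord_vertex -val_eqE /= inordK. Qed.

Lemma edge_param1 : edge_param (vertex 1 1) = I1 R.
Proof. by apply: val_inj; rewrite /= bcoord_vertex -val_eqE /= inordK. Qed.

End Prism.

Theorem cohom_pull_homotopic (R : realType) (A : comPzRingType) (X Y : topologicalType)
    (f g : continuousType X Y) (x : cohomology R A Y) :
  homotopic R f g -> cohom_pull f x = cohom_pull g x.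
Proof.
move=> [h [h_cont h0 h1]]; pose H := bundle_continuous h_cont.
rewrite -[x]cohom_classK !cohom_pull_class; move: (repr x) => a.
apply/esym/cohom_classP/asboolP; have /asboolP[aF a0] := cocycleP a.
exists (prism H (val a)); first exact: prism_finite.
rewrite (@prism_coboundary _ _ _ _ H f g).
- rewrite a0; suff -> : prism H (0 : cochain R A Y) = 0 by rewrite subr0.
  by apply: cochainP => n s; exact: prism_eq0.
- by move=> y; rewrite edge_param0 -h0.
- by move=> y; rewrite edge_param1 -h1.
Qed.

(** * Products of classes that vanish on the members of a cover *)

Section OpenCovers.
Context {R : realType} {A : comPzRingType}.
Implicit Types X Y Z : topologicalType.

Lemma cohom_pull_comp X Y Z (f : continuousType X Y) (g : continuousType Y Z)
    (k : continuousType X Z) (x : cohomology R A Z) :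
  (forall p, k p = g (f p)) -> cohom_pull k x = cohom_pull f (cohom_pull g x).
Proof.
move=> kE; rewrite -[x]cohom_classK !cohom_pull_class; congr cohom_class.
apply: val_inj; apply: cochainP => n s; rewrite /= /cochain_pull; congr (_ _).
by apply/continuousEP => t /=; exact: kE.
Qed.

Lemma singular_lift X (S : set X) n (s : singular R X n) : range s `<=` S ->
  exists s' : singular R S n, push_simplex (@Defs.incl X S) s' = s.
Proof.
move=> sS; have sP t : s t \in S by apply/mem_set/sS; exists t.
pose s' t : S := SigSub (sP t).
have s'_cont : continuous s'.
  by apply: (@continuous_comp_initial S _ _ set_val); exact: (@cts_fun _ _ s).
by exists (bundle_continuous s'_cont); apply/continuousEP.
Qed.

Lemma push_incl_inj X (S : set X) n :
  injective (@push_simplex R S X (@Defs.incl X S) n).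
Proof.
move=> s t st; apply/continuousEP => p; apply: val_inj.
exact: (congr1 (fun u : singular R X n => u p) st).
Qed.

(** Extension by zero.  It does not commute with the coboundary on simplices
    that leave [S], but no such simplex is a face of one inside [S]. *)
Definition extend_cochain X (S : set X) (e : cochain R A S) : cochain R A X :=
  fun n s => if pselect (exists s', push_simplex (@Defs.incl X S) s' = s) is left sP
             then e n (projT1 (cid sP)) else 0.

Lemma extend_cochain_pull X (S : set X) (e : cochain R A S) :
  cochain_pull (@Defs.incl X S) (extend_cochain e) = e.
Proof.
apply: cochainP => n s; rewrite /cochain_pull /extend_cochain.
case: pselect => [sP|]; last by case; exists s.
by case: cid => s' /= /push_incl_inj ->.
Qed.

Lemma coboundaryK X (e : cochain R A X) : coboundary (coboundary e) = 0.
Proof.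
apply: cochainP => n s; rewrite -[LHS]list_values_vertices -list_values_coboundary.
rewrite -[RHS](list_coboundaryK (list_values s e) (vertices n)).
by apply: eq_list_coboundary => l _; rewrite list_values_coboundary.
Qed.

Lemma finitely_graded_coboundary X (e : cochain R A X) :
  finitely_graded e -> finitely_graded (coboundary e).
Proof.
move=> [N eN]; exists N.+1 => -[//|n] s Nn.
by rewrite /coboundary big1 // => k _; rewrite eN ?mulr0.
Qed.

Lemma cohom_class_eq0 X (a : cocycle R A X) :
  cohom_class a = 0 <-> a \in coboundaries.
Proof.
have -> : (0 : cohomology R A X) = cohom_class 0.
  by rewrite -[LHS](subrr (cohom_class 0)) -cohom_classB subrr.
by rewrite -[X in X \in _]subr0; exact: cohom_classP.
Qed.

(** If the restriction of a cocycle to [S] is the coboundary of [e], subtracting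
    the coboundary of the extension of [e] by zero makes the cocycle vanish
    on all simplices inside [S]. *)
Lemma vanishing_representative X (S : set X) (x : cohomology R A X) :
  cohom_pull (@Defs.incl X S) x = 0 ->
  exists2 a, cohom_class a = x & vanishes_within S (val a).
Proof.
rewrite -{1}[x]cohom_classK cohom_pull_class; set a := repr x.
move=> /cohom_class_eq0/asboolP[e [N eN] ae].
pose e' := extend_cochain e.
have e'F : finitely_graded e'.
  by exists N => n s Nn; rewrite /e' /extend_cochain; case: pselect => // sP; exact: eN.
have e'_cocycle : is_cocycle (coboundary e').
  by apply/asboolP; split; [exact: finitely_graded_coboundary | exact: coboundaryK].
exists (a - Cocycle e'_cocycle).
  rewrite cohom_classB cohom_classK.
  have /cohom_class_eq0 -> : Cocycle e'_cocycle \in coboundaries.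
    by apply/asboolP; exists e'.
  by rewrite subr0.
move=> n s /singular_lift[s' <-]; rewrite /= cochainBE.
have := congr1 (fun b : cochain R A S => b n s') ae.
rewrite -[e]extend_cochain_pull -cochain_pull_coboundary => aE.
by apply/eqP; rewrite subr_eq0; apply/eqP.
Qed.

Lemma vanishes_within_cupr X (S : set X) (a b : cochain R A X) :
  vanishes_within S a -> vanishes_within S (a * b).
Proof.
move=> aS n s sS; rewrite cupE big1 // => i _; rewrite aS ?mul0r //.
by move=> _ [t _ <-]; apply: sS; exists (simplex_map n id t).
Qed.

Lemma vanishes_within_cupl X (S : set X) (a b : cochain R A X) :
  vanishes_within S b -> vanishes_within S (a * b).
Proof.
move=> bS n s sS; rewrite cupE big1 // => i _; rewrite [X in _ * X]bS ?mulr0 //.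
by move=> _ [t _ <-]; apply: sS; exists (simplex_map n (addn i) t).
Qed.

(** The Lusternik-Schnirelmann argument.  Since faces of a simplex in [U i] lie
    in [U i], a product of cocycles vanishes on every simplex on which one of the
    factors vanishes on all faces; so the product of the representatives of the
    [x i] vanishes on all simplices that fit into a member of the cover. *)
Theorem prod_eq0_of_cover X m (U : 'I_m -> set X) (x : 'I_m -> cohomology R A X) :
  (forall i, open (U i)) -> (forall p, exists i, U i p) ->
  (forall i, cohom_pull (@Defs.incl X (U i)) (x i) = 0) ->
  \prod_(i < m) x i = 0.
Proof.
move=> U_open U_cover /(_ _)/vanishing_representative xU.
have {xU} /choice[a aP] i : exists a, cohom_class a = x i /\ vanishes_within (U i) (val a).
  by have [a ax aU] := xU i; exists a.
have -> : \prod_(i < m) x i = cohom_class (\prod_(i < m) a i).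
  rewrite (big_morph (@cohom_class R A X) (@cohom_classM R A X) (erefl _)).
  by apply: eq_bigr => i _; rewrite (aP i).1.
apply/cohom_class_eq0/asboolP; set c := \prod_(i < m) a i.
have /asboolP[cF c0] := cocycleP c.
apply: (small_cocycle_coboundary U_open U_cover cF c0) => i.
have : i \in index_enum 'I_m by exact: mem_index_enum.
rewrite /c; elim: (index_enum _) => //= j r IHr; rewrite in_cons big_cons.
move=> /orP[/eqP <-|/IHr]; last exact: vanishes_within_cupl.
exact/vanishes_within_cupr/(aP i).2.
Qed.

End OpenCovers.

(** * Deforming paths *)

Section Paths.
Context {R : realType}.
Local Notation I := (unit_interval R).

Lemma unit_interval_compact : compact [set: I].
Proof.
pose f : R -> I := insubd (I0 R).
have fK (t : I) : f (val t) = t by exact: valKd.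
have f_cont : {within unit_interval R, continuous f}.
  apply/subspace_sigL_continuousP.
  have -> : sigL (unit_interval R) f = id by apply/funext => t; exact: fK.
  by move=> t; exact: cvg_id.
have -> : [set: I] = f @` unit_interval R.
  apply/seteqP; split=> // t _; exists (val t) => //.
  exact: set_mem (valP t).
apply: continuous_compact => //; exact: segment_compact.
Qed.

Lemma unit_interval_hausdorff : hausdorff_space I.
Proof.
move=> p q pq; apply: val_inj; apply: (@Rhausdorff R) => B C Bp Cq.
have val_cont : continuous (set_val : I -> R) by exact: initial_continuous.
have [t [Bt Ct]] := pq _ _ (val_cont _ _ Bp) (val_cont _ _ Cq).
by exists (val t).
Qed.

Lemma path_eval_continuous (X : topologicalType) :
  continuous (fun p : path_space R X * I => path_at p.1 p.2).
Proof.
have -> : (fun p : path_space R X * I => path_at p.1 p.2) = @eval I X.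
  by apply/funext => -[].
apply: eval_continuous.
  move=> t _; exists setT; first by rewrite withinET; exact: filterT.
  by split; [exact: unit_interval_compact|exact: closedT].
move=> t; apply: (@compact_regular _ t [set: I]).
- exact: unit_interval_hausdorff.
- exact: unit_interval_compact.
- exact: filterT.
Qed.

(** Paths shrink to their starting points, continuously in the path because
    evaluation is continuous on the compact Hausdorff interval. *)
Lemma endpoints_homotopic (T X : topologicalType) (sigma : T -> path_space R X) :
  continuous sigma ->
  homotopic R (@diag X \o (fun u => path_at (sigma u) (I0 R)))
    (@endpoints R X \o sigma).
Proof.
move=> sigma_cont.
have fst_cont : continuous (fst : T * I -> T) by move=> p; exact: cvg_fst.
have snd_cont : continuous (snd : T * I -> I) by move=> p; exact: cvg_snd.
have at_cont (g : T * I -> I) : continuous g ->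
    continuous (fun p : T * I => path_at (sigma p.1) (g p)).
  move=> g_cont p; apply: (@continuous_comp _ _ _ (fun p : T * I => (sigma p.1, g p))
    (fun q : path_space R X * I => path_at q.1 q.2)); last exact: path_eval_continuous.
  apply: (pair_continuous (f := fun p : T * I => sigma p.1)) => // {}p.
  by apply: continuous_comp; [exact: fst_cont|exact: sigma_cont].
exists (fun p => (path_at (sigma p.1) (I0 R), path_at (sigma p.1) p.2)).
split => //; apply: pair_continuous; apply: at_cont => // p; exact: cvg_cst.
Qed.

End Paths.

(** Write x as the image of y under (f x f)^*.  On [U] the map f x f is homotopic to
    its composite with [endpoints] and [sigma], so x restricts to the pull-back
    of x itself along the endpoints of [sigma].  That map deforms into the
    diagonal, on which x vanishes. *)
Lemma ker_cup_im_restrict (R : realType) (A : comPzRingType) (X Y : ptopologicalType)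
    (f : continuousType X Y) (U : set (X * X)) (sigma : U -> path_space R X) x :
  continuous sigma ->
  homotopic R (square_map f \o @endpoints R X \o sigma)
    (square_map f \o @Defs.incl _ U) ->
  ker_cup_im R A f x -> cohom_pull (@Defs.incl _ U) x = 0.
Proof.
move=> sigma_cont sigma_homotopy [[_ x_diag] [y _ yx]].
have [h [h_cont h0 h1]] := endpoints_homotopic sigma_cont.
have end_cont : continuous (@endpoints R X \o sigma).
  have -> : @endpoints R X \o sigma = fun u => h (u, I1 R) by apply/funext => u; rewrite h1.
  move=> u; apply: (@continuous_comp _ _ _ (fun u : U => (u, I1 R)) h); last exact: h_cont.
  by apply: (pair_continuous (f := @idfun U)) => p; [exact: cvg_id|exact: cst_continuous].
have start_cont : continuous (fun u => path_at (sigma u) (I0 R)).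
  move=> u; apply: (@continuous_comp _ _ _ (@endpoints R X \o sigma) fst).
    exact: end_cont.
  exact: cvg_fst.
pose e : continuousType U (X * X)%type := bundle_continuous end_cont.
pose p : continuousType U X := bundle_continuous start_cont.
have ex0 : cohom_pull e x = 0.
  rewrite -(@cohom_pull_homotopic _ _ _ _ (@diag X \o p) e); last by exists h.
  by rewrite (@cohom_pull_comp _ _ _ _ _ p (@diag X)) // x_diag raddf0.
rewrite -yx -(@cohom_pull_comp _ _ _ _ _ (@Defs.incl _ U) (square_map f)
  (square_map f \o @Defs.incl _ U)) //.
rewrite -(@cohom_pull_homotopic _ _ _ _ (square_map f \o e)); last exact: sigma_homotopy.
by rewrite (@cohom_pull_comp _ _ _ _ _ e (square_map f)) // yx.
Qed.

(** * The lower bound *)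

Local Open Scope ereal_scope.

Theorem proposition2p6 (R : realType) (A : comPzRingType)
  (X Y : ptopologicalType)
  (Xconn : path_connected R X) (Yconn : path_connected R Y)
  (Xcw : CW_homotopy_type R X) (Ycw : CW_homotopy_type R Y)
  (f : continuousType X Y) (f_pointed : f point = point) :
  nil_index R (ker_cup_im R A f) <= TC R f.
Proof.
apply: le_ereal_inf_tmp => _ [n [U [U_open U_cover U_section]] <-].
apply: ge_ereal_sup => _ [m m_nil <-]; rewrite lee_fin ler_nat.
case: m_nil => [->//|[x [xS]]]; apply: contraR; rewrite -ltnNge => nm; apply/eqP.
apply: (prod_eq0_of_cover (U := fun i : 'I_m => U (inord i))) => [i|p|i].
- exact: U_open.
- have [j _ Uj] : (\bigcup_i U i)%classic p by rewrite U_cover.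
  by exists (Ordinal (leq_trans (ltn_ord j) nm)); rewrite /= inord_val.
- have [sigma [sigma_cont sigma_homotopy]] := U_section (inord i).
  exact: ker_cup_im_restrict sigma_homotopy (xS i).
Qed.
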